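(* Suppose that a finitely generated group $G$ has one of the following properties: (a) each nontrivial quotient group of $G$ contains a nontrivial normal subgroup that is finite or abelian (for example, $G$ is solvable); (b) $G$ is linear. Then $G$ is unimodularly closed if and only if $G$ is nilpotent.
   Context: An equation $g_1x^{n_1}\cdots g_kx^{n_k}=1$ with one unknown $x$ over a group $G$ (where $g_i\in G$ and $n_i\in\mathbb{Z}$) is called unimodular if $\sum n_i=\pm1$. A group $G$ is called unimodularly closed if every unimodular equation over $G$ has a solution in $G$. A group is linear if it is isomorphic to a subgroup of $GL_m(F)$ for some positive integer $m$ and some field $F$. *)

(* Defs.v *)
From HB Require Import structures.
From mathcomp Require Import all_boot all_order all_algebra.
From mathcomp Require Import boolp classical_sets cardinality.

Set Implicit Arguments.
Unset Strict Implicit.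
Unset Printing Implicit Defensive.

Import GRing.Theory.

Local Open Scope classical_set_scope.
Local Open Scope group_scope.

(* [groupType] bundles a choice structure; with the classical axioms of [boolp]
   every type has one, so it ranges over all groups, finite or infinite. *)

Section Subgroups.
Variable G : groupType.
Implicit Types (A B S H N : set G).

Definition is_subgroup H : Prop :=
  [/\ H 1, forall x y, H x -> H y -> H (x * y) & forall x, H x -> H x^-1].

Definition is_normal N : Prop :=
  is_subgroup N /\ forall x g, N x -> N (x ^ g).

Definition is_abelian H : Prop :=
  forall x y, H x -> H y -> commute x y.

Definition gen_subgroup S : set G :=
  [set x | forall H, is_subgroup H -> S `<=` H -> H x].

Definition finitely_generated : Prop :=
  exists s : seq G, gen_subgroup [set` s] = setT.

Definition comm_subgroup A B : set G :=
  gen_subgroup [set [~ x, y] | x in A & y in B].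

Fixpoint lower_central n : set G :=
  if n is n'.+1 then comm_subgroup (lower_central n') setT else setT.

Definition nilpotent_group : Prop := exists n, lower_central n = [set 1].

Fixpoint derived_series n : set G :=
  if n is n'.+1 then comm_subgroup (derived_series n') (derived_series n')
  else setT.

Definition solvable_group : Prop := exists n, derived_series n = [set 1].

End Subgroups.

Record normalSubgroup (G : groupType) :=
  NormalSubgroup { ns_set : set G; ns_normal : is_normal ns_set }.

Section Quotient.
Variables (G : groupType) (N : normalSubgroup G).

Definition coset_rel : rel G := fun x y => `[< ns_set N (x^-1 * y) >].

Lemma ns1 : ns_set N 1.
Proof. by case: (ns_normal N) => -[]. Qed.

Lemma nsM x y : ns_set N x -> ns_set N y -> ns_set N (x * y).
Proof. by case: (ns_normal N) => -[_ + _ _]; apply. Qed.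

Lemma nsV x : ns_set N x -> ns_set N x^-1.
Proof. by case: (ns_normal N) => -[_ _ + _]; apply. Qed.

Lemma nsJ x g : ns_set N x -> ns_set N (x ^ g).
Proof. by case: (ns_normal N) => _; apply. Qed.

Lemma coset_rel_equiv : equiv_class_of coset_rel.
Proof.
split=> [x|x y|y x z].
- by apply/asboolP; rewrite mulVg; exact: ns1.
- by apply/asboolP/asboolP => /nsV; rewrite invgM invgK.
- move=> /asboolP xy /asboolP yz; apply/asboolP.
  by have := nsM xy yz; rewrite mulgA mulgK.
Qed.

Canonical coset_equiv := EquivRelPack coset_rel_equiv.

(* Left cosets of [N]; products and inverses are taken on representatives. *)
Definition quot_group := {eq_quot coset_equiv}%qT.
HB.instance Definition _ := Choice.on quot_group.
HB.instance Definition _ := EqQuotient.on quot_group.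

Definition quot_proj (x : G) : quot_group := (\pi_quot_group x)%qT.

Lemma quot_projP x y : reflect (ns_set N (x^-1 * y)) (quot_proj x == quot_proj y).
Proof. by rewrite /quot_proj piE; apply: asboolP. Qed.

Lemma quot_projK (a : quot_group) : quot_proj (repr a) = a.
Proof. exact: reprK. Qed.

Definition quot_one : quot_group := quot_proj 1.
Definition quot_inv (a : quot_group) : quot_group := quot_proj (repr a)^-1.
Definition quot_mul (a b : quot_group) : quot_group :=
  quot_proj (repr a * repr b).

Lemma quot_mulE x y : quot_mul (quot_proj x) (quot_proj y) = quot_proj (x * y).
Proof.
apply/eqP/quot_projP.
have /eqP/quot_projP xN := quot_projK (quot_proj x).
have /eqP/quot_projP yN := quot_projK (quot_proj y).
have := nsM (nsJ (repr (quot_proj y)) xN) yN.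
by rewrite /conjg invgM !mulgA mulgK.
Qed.

Lemma quot_invE x : quot_inv (quot_proj x) = quot_proj x^-1.
Proof.
apply/eqP/quot_projP.
have /eqP/quot_projP xN := quot_projK (quot_proj x).
by have := nsJ x^-1 (nsV xN); rewrite /conjg invgM !invgK !mulgA mulgV mul1g.
Qed.

Lemma quot_mulA : associative quot_mul.
Proof.
move=> a b c; rewrite -(quot_projK a) -(quot_projK b) -(quot_projK c).
by rewrite !quot_mulE mulgA.
Qed.

Lemma quot_mul1g : left_id quot_one quot_mul.
Proof. by move=> a; rewrite -(quot_projK a) quot_mulE mul1g. Qed.

Lemma quot_mulg1 : right_id quot_one quot_mul.
Proof. by move=> a; rewrite -(quot_projK a) quot_mulE mulg1. Qed.

Lemma quot_mulVg : left_inverse quot_one quot_inv quot_mul.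
Proof.
by move=> a; rewrite -(quot_projK a) quot_invE quot_mulE mulVg.
Qed.

Lemma quot_mulgV : right_inverse quot_one quot_inv quot_mul.
Proof.
by move=> a; rewrite -(quot_projK a) quot_invE quot_mulE mulgV.
Qed.

HB.instance Definition _ := isGroup.Build quot_group
  quot_mulA quot_mul1g quot_mulg1 quot_mulVg quot_mulgV.

End Quotient.

Definition quotients_have_finite_or_abelian_normal (G : groupType) : Prop :=
  forall N : normalSubgroup G,
    [set: quot_group N] <> [set 1] ->
    exists K : set (quot_group N),
      [/\ is_normal K, K <> [set 1] & finite_set K \/ is_abelian K].

Section GeneralLinear.
Local Open Scope ring_scope.
Variables (F : fieldType) (m : nat).

Definition GL := {A : 'M[F]_m | A \in unitmx}.
HB.instance Definition _ := SubChoice.on GL.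

Lemma GL_mul_proof (A B : GL) : val A *m val B \in unitmx.
Proof. by rewrite unitmx_mul !(valP A, valP B). Qed.
Lemma GL_inv_proof (A : GL) : invmx (val A) \in unitmx.
Proof. by rewrite unitmx_inv (valP A). Qed.

Definition GL_one : GL := Sub 1%:M (unitmx1 F m).
Definition GL_mul (A B : GL) : GL := Sub (val A *m val B) (GL_mul_proof A B).
Definition GL_inv (A : GL) : GL := Sub (invmx (val A)) (GL_inv_proof A).

Lemma GL_mulA : associative GL_mul.
Proof. by move=> A B C; apply: val_inj; rewrite /= mulmxA. Qed.
Lemma GL_mul1g : left_id GL_one GL_mul.
Proof. by move=> A; apply: val_inj; rewrite /= mul1mx. Qed.
Lemma GL_mulg1 : right_id GL_one GL_mul.
Proof. by move=> A; apply: val_inj; rewrite /= mulmx1. Qed.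
Lemma GL_mulVg : left_inverse GL_one GL_inv GL_mul.
Proof. by move=> A; apply: val_inj; rewrite /= mulVmx // (valP A). Qed.
Lemma GL_mulgV : right_inverse GL_one GL_inv GL_mul.
Proof. by move=> A; apply: val_inj; rewrite /= mulmxV // (valP A). Qed.

HB.instance Definition _ :=
  isGroup.Build GL GL_mulA GL_mul1g GL_mulg1 GL_mulVg GL_mulgV.

End GeneralLinear.

Definition linear_group (G : groupType) : Prop :=
  exists (F : fieldType) (m : nat) (H : set (GL F m))
         (f : {multiplicative G -> GL F m}),
    [/\ (0 < m)%N, is_subgroup H, injective f & range f = H].

Definition expgz (G : groupType) (x : G) (n : int) : G :=
  match n with Posz k => x ^+ k | Negz k => x ^- k.+1 end.

(* The list [:: (g_1, n_1); ...; (g_k, n_k)] encodes the equation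
   g_1 x^{n_1} ... g_k x^{n_k} = 1. *)
Definition equation (G : groupType) := seq (G * int).

Definition is_solution (G : groupType) (w : equation G) (x : G) : Prop :=
  \prod_(p <- w) (p.1 * expgz x p.2) = 1.

Definition unimodular (G : groupType) (w : equation G) : Prop :=
  (\sum_(p <- w) p.2 = 1 \/ \sum_(p <- w) p.2 = -1)%R.

Definition unimodularly_closed (G : groupType) : Prop :=
  forall w : equation G, unimodular w -> exists x : G, is_solution w x.

(* Main.v *)
Require Import Defs.
From HB Require Import structures.
From mathcomp Require Import all_boot all_order all_algebra all_field.
From mathcomp Require Import finmap boolp classical_sets cardinality.

(* If [G] is nilpotent, a unimodular equation is solved modulo deeper and deeper
   terms of the lower central series; the same computation shows that a solution
   is unique.

   Conversely, a finitely generated non-nilpotent [G] satisfying (a) has a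
   quotient [Q] all of whose proper quotients are nilpotent; [Q] has trivial
   center and a nontrivial normal subgroup that is finite or abelian.
   By uniqueness of solutions modulo a normal subgroup [B <> 1], a unimodular
   word map fixing [1] maps [B] onto [B].  If [B] is finite and minimal normal
   then [B = [B, Q]], so that some [b <> 1] is the value at [b] of a word [w] of
   exponent sum zero, and [x w(x)^-1] is not injective on [B].  If [V] is the
   normal closure of one element and is abelian, choose [z] acting on [V]
   nontrivially and commuting with the action of [Q], and let [Z[X]] act on [V]
   through [z].  Its annihilator [P] is prime, polynomials outside [P] act
   injectively, and polynomials with value 1 at 1 act surjectively.  Following a
   polycyclic series of [Q / V] downwards (P. Hall), one finds [a] outside [P]
   such that every [1 + a g] is invertible on a cyclic [Z[X]]-module with
   annihilator [P].  But [Z[X] / P] has a finite residue field in which [a]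
   survives, and there [1 + a g] vanishes for some [g].

   A linear [G] is reduced modulo primes of a finitely generated ring containing
   its matrix entries.  The images are finite, hence nilpotent by the previous
   case, and nilpotent groups of [m x m] matrices have derived length at most
   [2 m]; therefore [G] is solvable, and satisfies (a). *)

Set Implicit Arguments.
Unset Strict Implicit.
Unset Printing Implicit Defensive.

Import GRing.Theory.

Local Open Scope classical_set_scope.
Local Open Scope group_scope.

(** * Subgroups, quotients and words *)

Section SubgroupTheory.
Variable G : groupType.
Implicit Types (A B S H N : set G) (x y g : G).

Lemma setT_normal : is_normal [set: G].
Proof. by []. Qed.

Lemma gen_subgroupP S : is_subgroup (gen_subgroup S).
Proof.
split=> [H [] //|x y Sx Sy H sH SH|x Sx H sH SH].
  by case: (sH) => _ + _; apply; [exact: Sx|exact: Sy].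
by case: (sH) => _ _; apply; exact: Sx.
Qed.

Lemma sub_gen_subgroup S : S `<=` gen_subgroup S.
Proof. by move=> x Sx H _; apply. Qed.

Lemma gen_subgroup_normal S :
  (forall x g, S x -> S (x ^ g)) -> is_normal (gen_subgroup S).
Proof.
move=> SJ; split=> [|x g Sx H sH SH]; first exact: gen_subgroupP.
suff: [set y | H (y ^ g)] x by [].
apply: Sx => [|y Sy]; last exact/SH/SJ.
case: sH => H1 HM HV; split=> /= [|u v|u]; rewrite ?conj1g ?conjMg ?conjVg //.
  exact: HM.
exact: HV.
Qed.

Lemma comm_subgroup_min A B H : is_subgroup H ->
  (forall x y, A x -> B y -> H [~ x, y]) -> comm_subgroup A B `<=` H.
Proof. by move=> sH AB x; apply=> // _ [u Au [v Bv <-]]; exact: AB. Qed.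

Lemma mem_comm_subgroup A B x y : A x -> B y -> comm_subgroup A B [~ x, y].
Proof. by move=> Ax By; apply: sub_gen_subgroup; exists x => //; exists y. Qed.

Lemma comm_subgroup_normal A B :
  is_normal A -> is_normal B -> is_normal (comm_subgroup A B).
Proof.
move=> [_ AJ] [_ BJ]; apply: gen_subgroup_normal => _ g [u Au [v Bv <-]].
by exists (u ^ g); [exact: AJ|exists (v ^ g); [exact: BJ|rewrite conjRg]].
Qed.

Lemma comm_subgroupS A A' B B' :
  A `<=` A' -> B `<=` B' -> comm_subgroup A B `<=` comm_subgroup A' B'.
Proof.
move=> AA BB; apply: comm_subgroup_min; first exact: gen_subgroupP.
by move=> x y /AA ? /BB ?; exact: mem_comm_subgroup.
Qed.

Lemma comm_subgroup_sub N B : is_normal N -> comm_subgroup N B `<=` N.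
Proof.
move=> [sN NJ]; apply: comm_subgroup_min => // x y Nx _.
by case: sN => _ NM NV; apply: NM; [exact: NV|exact: NJ].
Qed.

Lemma lower_central_normal n : is_normal (lower_central (G := G) n).
Proof.
by elim: n => [|n IHn]; [exact: setT_normal|exact: comm_subgroup_normal].
Qed.

Lemma derived_series_normal n : is_normal (derived_series (G := G) n).
Proof.
by elim: n => [|n IHn]; [exact: setT_normal|exact: comm_subgroup_normal].
Qed.

Lemma lower_central_comm n x g :
  lower_central n x -> lower_central n.+1 [~ x, g].
Proof. by move=> Lx; apply: mem_comm_subgroup. Qed.

Lemma lower_centralS n : lower_central (G := G) n.+1 `<=` lower_central n.
Proof. by apply: comm_subgroup_sub; exact: lower_central_normal. Qed.

Lemma set1_normal : is_normal [set (1 : G)].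
Proof.
split=> [|x g ->]; last exact: conj1g.
by split=> //= [x y -> ->|x ->]; rewrite ?mulg1 ?invg1.
Qed.

Lemma normal1 N : is_normal N -> N 1.
Proof. by case=> -[]. Qed.

Lemma normalM N x y : is_normal N -> N x -> N y -> N (x * y).
Proof. by case=> -[_ NM _] _ Nx Ny; exact: NM. Qed.

Lemma normalV N x : is_normal N -> N x -> N x^-1.
Proof. by case=> -[_ _ NV] _ Nx; exact: NV. Qed.

Lemma normalJ N x g : is_normal N -> N x -> N (x ^ g).
Proof. by case=> _; apply. Qed.

Lemma normal_sub1 N : is_normal N -> N `<=` [set 1] -> N = [set 1].
Proof. by move=> nN sN; apply/seteqP; split=> // _ ->; exact: normal1. Qed.

Lemma nilpotentE : nilpotent_group G <-> exists n, lower_central (G := G) n `<=` [set 1].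
Proof.
split=> -[n nG]; exists n; first by rewrite nG.
exact/normal_sub1/nG/lower_central_normal.
Qed.

(** The preimage in [G] of the center of [G / N]. *)
Definition central_mod N : set G := [set x | forall g, N [~ x, g]].

Lemma central_mod_normal N : is_normal N -> is_normal (central_mod N).
Proof.
move=> nN; split=> [|x h Nx g]; last first.
  have /(normalJ h nN) := Nx (g ^ h^-1); rewrite conjRg.
  by rewrite -conjgM mulVg conjg1.
split=> [g|x y Nx Ny g|x Nx g]; first by rewrite comm1g; exact: normal1.
- suff ->: [~ x * y, g] = [~ x, g] ^ y * [~ y, g].
    by apply: normalM => //; apply: normalJ.
  by rewrite !commgEl /conjg !invgM !mulgA !gnorm.
- suff ->: [~ x^-1, g] = ([~ x, g] ^ x^-1)^-1.
    by apply: normalV => //; apply: normalJ.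
  by rewrite /commg /conjg !invgM !invgK !mulgA !gnorm.
Qed.

Lemma centralizer_mod_subgroup N x : is_normal N ->
  is_subgroup [set g | N [~ x, g]].
Proof.
move=> nN; split=> /= [|g h Ng Nh|g Ng]; first by rewrite commg1; exact: normal1.
- suff ->: [~ x, g * h] = [~ x, h] * [~ x, g] ^ h.
    by apply: normalM => //; apply: normalJ.
  by rewrite !commgEl /conjg !invgM !mulgA !gnorm.
- suff ->: [~ x, g^-1] = ([~ x, g] ^ g^-1)^-1.
    by apply: normalV => //; apply: normalJ.
  by rewrite /commg /conjg !invgM !invgK !mulgA !gnorm.
Qed.

(* The left-normed commutators of weight [n.+1] in the letters [s]. *)
Fixpoint left_normed (s : seq G) n : seq G :=
  if n is n'.+1 then [seq [~ c, g] | c <- left_normed s n', g <- s] else s.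

Lemma left_normed_lower_central s n : [set` left_normed s n] `<=` lower_central n.
Proof.
elim: n => //= n IHn _ /allpairsP [[c g] /= [/IHn Lc _ ->]].
exact: lower_central_comm.
Qed.

(** Induction on [n] for all [N] at once. If [N] contains the longer commutators, the shorter ones
    are central modulo [N], since commuting with the generators is enough, and the induction
    hypothesis applies to [central_mod N]. *)
Lemma lower_central_normal_closure s n N :
  gen_subgroup [set` s] = setT -> is_normal N ->
  [set` left_normed s n] `<=` N -> lower_central n `<=` N.
Proof.
move=> gens; elim: n N => [|n IHn] N nN sN.
  by rewrite /= -gens => x; apply=> //; case: nN.
have sub : lower_central n `<=` central_mod N.
  apply: IHn; first exact: central_mod_normal.
  move=> c sc g; have : gen_subgroup [set` s] g by rewrite gens.
  move=> /(_ _ (centralizer_mod_subgroup c nN)); apply.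
  by move=> h sh; apply: sN; apply/allpairsP; exists (c, h).
by apply: comm_subgroup_min => [|x y /sub Nx _]; [case: nN|exact: Nx].
Qed.

End SubgroupTheory.

Section Quotients.
Variables (G : groupType) (N : normalSubgroup G).

Lemma quot_projM : {morph quot_proj N : x y / x * y}.
Proof. by move=> x y; rewrite -quot_mulE. Qed.

Lemma quot_projV : {morph quot_proj N : x / x^-1}.
Proof. by move=> x; rewrite -quot_invE. Qed.

Lemma quot_proj1 : quot_proj N 1 = 1.
Proof. by []. Qed.

Lemma quot_projR : {morph quot_proj N : x y / [~ x, y]}.
Proof. by move=> x y; rewrite /commg /conjg !(quot_projM, quot_projV). Qed.

Lemma quot_projJ : {morph quot_proj N : x y / x ^ y}.
Proof. by move=> x y; rewrite /conjg !(quot_projM, quot_projV). Qed.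

Lemma quot_proj_eq x y : quot_proj N x = quot_proj N y <-> ns_set N (x^-1 * y).
Proof. by split=> [/eqP/quot_projP //|h]; apply/eqP/quot_projP. Qed.

Lemma quot_proj_eq1 x : quot_proj N x = 1 <-> ns_set N x.
Proof.
split=> [e|Nx]; last by apply/esym/quot_proj_eq; rewrite invg1 mul1g.
by have /quot_proj_eq := esym e; rewrite invg1 mul1g.
Qed.

Lemma preimage_normal (K : set (quot_group N)) :
  is_normal K -> is_normal (quot_proj N @^-1` K).
Proof.
move=> nK; split=> [|x g /= Kx]; last by rewrite quot_projJ; exact: normalJ.
split=> /= [|x y Kx Ky|x Kx]; rewrite ?quot_projM ?quot_projV.
- exact: (normal1 nK).
- exact: normalM.
- exact: normalV.
Qed.

Lemma quot_gen_subgroup S :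
  gen_subgroup (quot_proj N @` S) = quot_proj N @` gen_subgroup S.
Proof.
apply/seteqP; split=> [a Sa|_ [x Sx <-] H sH SH].
  apply: Sa => [|_ [x Sx <-]]; last by exists x => //; exact: sub_gen_subgroup.
  have [g1 gM gV] := gen_subgroupP S.
  split=> [|_ _ [x Sx <-] [y Sy <-]|_ [x Sx <-]].
  - by exists 1.
  - by exists (x * y); rewrite ?quot_projM //; exact: gM.
  - by exists x^-1; rewrite ?quot_projV //; exact: gV.
apply: (Sx (quot_proj N @^-1` H)) => [|y Sy]; last by apply: SH; exists y.
case: sH => H1 HM HV; split=> /= [|u v|u]; rewrite ?quot_projM ?quot_projV //.
- exact: HM.
- exact: HV.
Qed.

Lemma quot_comm_subgroup A B :
  comm_subgroup (quot_proj N @` A) (quot_proj N @` B) =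
  quot_proj N @` comm_subgroup A B.
Proof.
rewrite -quot_gen_subgroup; congr gen_subgroup; apply/seteqP; split.
  move=> _ [_ [x Ax <-] [_ [y By <-] <-]]; exists [~ x, y]; last exact: quot_projR.
  by exists x => //; exists y.
move=> _ [_ [x Ax [y By <-]] <-]; exists (quot_proj N x); first by exists x.
by exists (quot_proj N y); [exists y|rewrite quot_projR].
Qed.

Lemma quot_proj_setT : quot_proj N @` setT = setT.
Proof.
by apply/seteqP; split=> // a _; exists (repr a) => //; rewrite quot_projK.
Qed.

Lemma quot_lower_central n :
  lower_central (G := quot_group N) n = quot_proj N @` lower_central n.
Proof.
elim: n => [|n /= ->]; first by rewrite /= quot_proj_setT.
by rewrite -[in LHS]quot_proj_setT quot_comm_subgroup.
Qed.

Lemma quot_derived_series n :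
  derived_series (G := quot_group N) n = quot_proj N @` derived_series n.
Proof.
elim: n => [|n /= ->]; first by rewrite /= quot_proj_setT.
by rewrite quot_comm_subgroup.
Qed.

Lemma quot_nilpotent n :
  lower_central n `<=` ns_set N -> nilpotent_group (quot_group N).
Proof.
move=> sN; apply/nilpotentE; exists n.
by rewrite quot_lower_central => _ [x /sN Nx <-]; exact/quot_proj_eq1.
Qed.

Lemma quot_finitely_generated :
  finitely_generated G -> finitely_generated (quot_group N).
Proof.
move=> [s gens]; exists [seq quot_proj N x | x <- s].
rewrite -quot_proj_setT -gens -quot_gen_subgroup; congr gen_subgroup.
apply/seteqP; split=> [_ /mapP [x xs ->]|_ [x xs <-]]; first by exists x.
exact: map_f.
Qed.

End Quotients.

(** * Integer powers *)

Section IntegerPowers.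
Variable G : groupType.
Implicit Types (x y : G) (m n : int).

(** Writing exponents as differences of naturals spares [expgzD] the case analysis on signs. *)
Lemma expgz_sub x (a b : nat) : expgz x (a%:Z - b%:Z)%R = x ^+ a / x ^+ b.
Proof.
have [ab|ba] := leqP a b.
  rewrite -opprB subzn // -[in RHS](subnK ab) expgnDr invgM mulgA mulgV mul1g.
  case: (b - a)%N => [|k]; first by rewrite oppr0 /= invg1.
  by rewrite -NegzE.
by rewrite subzn ?(ltnW ba) //= expgnFr // ltnW.
Qed.

Lemma int_subP n : exists a b : nat, n = (a%:Z - b%:Z)%R.
Proof.
case: n => k; first by exists k, 0; rewrite subr0.
by exists 0, k.+1; rewrite NegzE sub0r.
Qed.

Lemma expgzD x m n : expgz x (m + n)%R = expgz x m * expgz x n.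
Proof.
have [a [b ->]] := int_subP m; have [c [d ->]] := int_subP n.
rewrite (_ : _ + _ = (a + c)%N%:Z - (b + d)%N%:Z)%R; last first.
  by rewrite !PoszD opprD addrACA.
rewrite !expgz_sub expgnDr (addnC b) expgnDr invgM !mulgA.
have cV k l : commute (x ^+ k) (x ^- l) by exact/commuteV/commuteX2.
by rewrite -(mulgA (x ^+ a) (x ^+ c)) (cV c b) !mulgA.
Qed.

Lemma expgzN x n : expgz x (- n)%R = (expgz x n)^-1.
Proof. by apply/esym/mulg1_eq; rewrite -expgzD subrr. Qed.

Lemma expgzM x y n : commute x y -> expgz (x * y) n = expgz x n * expgz y n.
Proof.
move=> xy; case: n => k /=; first exact: expgMn.
by rewrite xy expgMn ?invgM //; exact: commute_sym.
Qed.

Lemma expgz_commute x y n : commute x y -> commute x (expgz y n).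
Proof.
by move=> xy; case: n => k; [exact: commuteX|exact/commuteV/commuteX].
Qed.

End IntegerPowers.

(** * Word maps, and unimodular equations over nilpotent groups *)

Definition weval (G : groupType) (w : equation G) (x : G) : G :=
  \prod_(p <- w) (p.1 * expgz x p.2).

Definition wsum (G : groupType) (w : equation G) : int := (\sum_(p <- w) p.2)%R.

(** Remembers the map and the exponent sum but not the word, so that words can be combined
    pointwise. *)
Definition word_map (G : groupType) (e : int) (f : G -> G) : Prop :=
  exists2 w, wsum w = e & weval w =1 f.

Section WordMaps.
Variable G : groupType.
Implicit Types (w : equation G) (x y g : G) (f h : G -> G) (e : int).

Lemma weval_nil x : weval [::] x = 1.
Proof. exact: big_nil. Qed.

Lemma weval_cons p w x : weval (p :: w) x = p.1 * expgz x p.2 * weval w x.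
Proof. exact: big_cons. Qed.

Lemma wsum_cons p w : wsum (p :: w) = (p.2 + wsum w)%R.
Proof. exact: big_cons. Qed.

Lemma wsum_nil : wsum (G := G) [::] = 0%R.
Proof. exact: big_nil. Qed.

Lemma weval_cat w1 w2 x : weval (w1 ++ w2) x = weval w1 x * weval w2 x.
Proof. exact: big_cat. Qed.

Lemma word_mapM d e f h : word_map d f -> word_map e h ->
  word_map (d + e)%R (fun x => f x * h x).
Proof.
move=> [v <- vf] [w <- wh]; exists (v ++ w); first exact: big_cat.
by move=> x; rewrite weval_cat vf wh.
Qed.

Lemma word_map_const g : word_map 0 (fun=> g).
Proof.
exists [:: (g, 0%R)]; first by rewrite wsum_cons wsum_nil addr0.
by move=> x; rewrite weval_cons weval_nil !mulg1.
Qed.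

Lemma word_map_expgz e : word_map e (fun x => expgz x e).
Proof.
exists [:: (1, e)]; first by rewrite wsum_cons wsum_nil addr0.
by move=> x; rewrite weval_cons weval_nil mulg1 mul1g.
Qed.

Lemma word_map_id : word_map (G := G) 1 id.
Proof. exact: (word_map_expgz 1). Qed.

Lemma word_mapV e f : word_map e f -> word_map (- e)%R (fun x => (f x)^-1).
Proof.
move=> [w <- wf].
have : word_map (- wsum w)%R (fun x => (weval w x)^-1).
  elim: w {wf} => [|p w IHw].
    exists [::]; first by rewrite wsum_nil oppr0.
    by move=> x; rewrite !weval_nil invg1.
  have := word_mapM IHw (word_mapM (word_map_expgz (- p.2)%R) (word_map_const p.1^-1)).
  rewrite addr0 wsum_cons opprD addrC => -[v vE vf]; exists v => // x.
  by rewrite vf weval_cons !invgM expgzN.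
by case=> v vE vf; exists v => // x; rewrite vf wf.
Qed.

Lemma word_mapJ e f g : word_map e f -> word_map e (fun x => f x ^ g).
Proof.
move=> wf.
have := word_mapM (word_map_const g^-1) (word_mapM wf (word_map_const g)).
by rewrite addr0 add0r.
Qed.

(** Appending the constant [y^-1] to the word turns f x = y into a unimodular equation. *)
Lemma unimodularly_closed_map e f : e = 1%R \/ e = (-1)%R ->
  unimodularly_closed G -> word_map e f -> forall y, exists x, f x = y.
Proof.
move=> e1 uG wf y.
have := word_mapM wf (word_map_const y^-1); rewrite addr0 => -[w we wE].
have [|x] := uG w; first by case: e1 => e1; [left|right]; rewrite -e1 -we.
by rewrite /is_solution => wx; exists x; apply/divg1_eq; rewrite -wE.
Qed.

(** A central factor moves out of every power, so only the exponent sum sees it. Existence and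
    uniqueness of solutions in nilpotent groups both rest on this. *)
Lemma weval_central w y t : (forall g, commute t g) ->
  weval w (y * t) = weval w y * expgz t (wsum w).
Proof.
move=> ct; elim: w => [|p w IHw]; first by rewrite !weval_nil wsum_nil mulg1.
have ctz n g : commute (expgz t n) g.
  by apply: commute_sym; apply: expgz_commute; apply: commute_sym; exact: ct.
rewrite !weval_cons wsum_cons IHw expgzM ?expgzD; last by apply: commute_sym; exact: ct.
by rewrite -!mulgA; congr (_ * (_ * _)); rewrite !mulgA ctz.
Qed.

Lemma word_mapR e f g : word_map e f -> word_map 0 (fun x => [~ f x, g]).
Proof.
by move=> wf; have := word_mapM (word_mapV wf) (word_mapJ g wf); rewrite addNr.
Qed.

End WordMaps.

Section WordsAndQuotients.
Variable G : groupType.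
Implicit Types (w : equation G) (x y g : G) (f : G -> G) (e : int).

Lemma expgz_quot (N : normalSubgroup G) x e :
  quot_proj N (expgz x e) = expgz (quot_proj N x) e.
Proof.
have X k : quot_proj N (x ^+ k) = quot_proj N x ^+ k.
  by elim: k => [|k IHk]; rewrite // !expgS quot_projM IHk.
by case: e => k /=; rewrite ?quot_projV X.
Qed.

Lemma weval_quot (N : normalSubgroup G) (w : equation (quot_group N)) x :
  weval w (quot_proj N x) = quot_proj N (weval [seq (repr p.1, p.2) | p <- w] x).
Proof.
rewrite /weval big_map; elim: w => [|p w IHw]; first by rewrite !big_nil.
by rewrite !big_cons IHw !quot_projM quot_projK expgz_quot.
Qed.

Lemma word_map_quot (N : normalSubgroup G) e f : word_map e f ->
  exists2 h, word_map e h & forall x, h (quot_proj N x) = quot_proj N (f x).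
Proof.
move=> [w <- wf]; pose wN := [seq (quot_proj N p.1, p.2) | p <- w].
exists (weval wN) => [|x]; first by exists wN => //; rewrite /wsum /wN big_map.
rewrite -wf /weval /wN big_map.
elim: w {wN wf} => [|p w IHw]; first by rewrite !big_nil.
by rewrite !big_cons IHw !quot_projM expgz_quot.
Qed.

(** If [x^-1 * y] lies in one term of the lower central series, its image [t] modulo the next term
    is central, and f x = f y becomes t^e = 1 with e = 1 or -1. So [x^-1 * y] lies in every term. *)
Lemma nilpotent_word_map_inj e f : e = 1%R \/ e = (-1)%R ->
  nilpotent_group G -> word_map e f -> injective f.
Proof.
move=> e1 /nilpotentE [n nG] wf x y fxy.
suff L k : lower_central k (x^-1 * y).
  by apply/eqP; rewrite eq_sym -(mulVKg x y) (nG _ (L n)) mulg1.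
elim: k => // k IHk.
pose N := NormalSubgroup (@lower_central_normal G k.+1).
have [h [w wE /= wf'] hf] := word_map_quot N wf.
apply/(quot_proj_eq1 N); set t := quot_proj N _.
have ct (a : quot_group N) : commute t a.
  rewrite -(quot_projK a); apply/commgP/eqP; rewrite -quot_projR.
  by apply/quot_proj_eq1; apply: lower_central_comm.
have := hf y; rewrite -fxy -hf -[in LHS](mulVKg x y) quot_projM -!wf'.
rewrite weval_central // wE -[RHS]mulg1 => /mulgI.
by case: e1 => -> /=; [|move/eqP; rewrite invg_eq1 => /eqP].
Qed.

Lemma nilpotent_unimodularly_closed :
  nilpotent_group G -> unimodularly_closed G.
Proof.
move=> /nilpotentE [n nG] w e1.
suff [x /nG] : exists x, lower_central n (weval w x) by exists x.
elim: n {nG} => [|n [x IHn]]; first by exists 1.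
pose N := NormalSubgroup (@lower_central_normal G n.+1).
have wf : word_map (wsum w) (weval w) by exists w.
have [h [v vE /= vf] hf] := word_map_quot N wf.
pose t := quot_proj N (weval w x).
have ct (a : quot_group N) : commute t a.
  rewrite -(quot_projK a); apply/commgP/eqP; rewrite -quot_projR.
  by apply/quot_proj_eq1; apply: lower_central_comm.
(* The correcting factor t^(-e) contributes its e-th power. As e^2 = 1 this is t^-1, which cancels
   the error [t]. *)
exists (x * repr (expgz t (- wsum w)%R)).
apply/(quot_proj_eq1 N); rewrite -hf quot_projM quot_projK -vf.
rewrite weval_central => [|g]; last by apply: commute_sym; apply: expgz_commute; apply: commute_sym; exact: ct.
rewrite vf hf -/t vE.
by case: e1; rewrite /wsum => -> /=; rewrite ?invgK ?expg1 mulgV.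
Qed.

End WordsAndQuotients.

Lemma quot_unimodularly_closed (G : groupType) (N : normalSubgroup G) :
  unimodularly_closed G -> unimodularly_closed (quot_group N).
Proof.
move=> uG w; pose v := [seq (repr p.1, p.2) | p <- w] => e1.
have [|x vx] := uG v; first by rewrite /unimodular /v !big_map.
exists (quot_proj N x); rewrite /is_solution.
by rewrite -/(weval w _) weval_quot /weval vx.
Qed.

(** * Solvable groups satisfy (a) *)

Lemma derived_subgroup_abelian (G : groupType) n :
  derived_series (G := G) n.+1 `<=` [set 1] -> is_abelian (derived_series (G := G) n).
Proof.
by move=> D1 x y Dx Dy; apply/commgP/eqP/D1; apply: mem_comm_subgroup.
Qed.

(** The last nontrivial term of the derived series of the quotient is abelian. *)
Lemma solvable_quotients (G : groupType) :
  solvable_group G -> quotients_have_finite_or_abelian_normal G.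
Proof.
move=> [n Dn] N ntN.
have : exists k, derived_series (G := quot_group N) k `<=` [set 1].
  by exists n; rewrite quot_derived_series Dn => _ [x -> <-].
move=> /cid [k Dk]; elim: k Dk => [|k IHk] Dk.
  by case: ntN; apply: (normal_sub1 _ Dk); exact: setT_normal.
have [/(normal_sub1 _)|] := pselect (derived_series (G := quot_group N) k `<=` [set 1]).
  by move=> D1; apply: IHk; rewrite D1 //; exact: derived_series_normal.
move=> ntD; exists (derived_series k); split.
- exact: derived_series_normal.
- by move=> D1; apply: ntD; rewrite D1.
- by right; apply: derived_subgroup_abelian.
Qed.

(** * Operator modules *)

Local Open Scope ring_scope.

Section OperatorModules.
Variables (J : comNzRingType) (V : lmodType J).
Variables (I : Type) (act : I -> {linear V -> V}).
Implicit Types (O : set I) (M N : set V) (u v w : V) (y : I).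

(** Only an additive subgroup is required, since the ascent will start from the integer multiples of
    one vector; closure under [J] is recorded separately by [scale_closed]. *)
Definition stable O N : Prop :=
  [/\ N 0, forall u v, N u -> N v -> N (u - v)
    & forall i v, O i -> N v -> N (act i v)].

Definition scale_closed N : Prop := forall (a : J) v, N v -> N (a *: v).

(** Noetherianity of [M] over the ring generated by the operators in [O]. *)
Definition acc O M : Prop := forall N : nat -> set V,
  (forall k, stable O (N k)) -> (forall k, N k `<=` N k.+1) ->
  (forall k, N k `<=` M) -> exists k0, forall k, N k `<=` N k0.

(** A twisted commutation rule, as in skew polynomial rings. The first half makes the layers stable,
    the second the sets of leading coefficients. *)
Definition normalizes O y : Prop :=
  (forall o, O o -> exists2 o', O o' & forall v, act o (act y v) = act y (act o' v)) /\
  (forall o, O o -> exists2 o', O o' & forall v, act y (act o v) = act o' (act y v)).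

(** Polynomials in [y] of degree at most [n] with coefficients in [M]. In the successor case [n] is
    still the full argument, so the added term has degree n'+1. *)
Fixpoint layer y M n : set V :=
  if n is n'.+1 then
    [set v | exists u w, [/\ layer y M n' u, M w & v = u + iter n (act y) w]]
  else M.

(* The sum of the [y^n M]. *)
Definition adjoin y M : set V := [set v | exists n, layer y M n v].

Lemma stable0 O N : stable O N -> N 0.
Proof. by case. Qed.

Lemma stableB O N u v : stable O N -> N u -> N v -> N (u - v).
Proof. by case=> _ NB _; exact: NB. Qed.

Lemma stableN O N u : stable O N -> N u -> N (- u).
Proof. by move=> sN Nu; rewrite -sub0r; exact: stableB sN (stable0 sN) Nu. Qed.

Lemma stableD O N u v : stable O N -> N u -> N v -> N (u + v).
Proof.
by move=> sN Nu Nv; rewrite -[v]opprK; exact: stableB sN Nu (stableN sN Nv).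
Qed.

Lemma stable_act O N i v : stable O N -> O i -> N v -> N (act i v).
Proof. by case=> _ _; apply. Qed.

Lemma chain_leq (N : nat -> set V) j k :
  (forall k, N k `<=` N k.+1) -> (j <= k)%N -> N j `<=` N k.
Proof.
move=> NS /subnK <-; elim: (k - j)%N => [|i IHi] //.
by apply: subset_trans IHi _; exact: NS.
Qed.

Lemma iter_actB y n u v :
  iter n (act y) (u - v) = iter n (act y) u - iter n (act y) v.
Proof. by elim: n => //= n ->; rewrite linearB. Qed.

Lemma iter_actZ y n a v : iter n (act y) (a *: v) = a *: iter n (act y) v.
Proof. by elim: n => //= n ->; rewrite linearZ. Qed.

Lemma iter_act0 y n : iter n (act y) 0 = 0.
Proof. by elim: n => //= n ->; rewrite linear0. Qed.

Lemma stableMz O N v n : stable O N -> N v -> N (v *~ n).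
Proof.
move=> sN Nv; have NMn k : N (v *+ k).
  elim: k => [|k IHk]; first exact: stable0 sN.
  by rewrite mulrS; exact: stableD sN _ _.
case: n => k; first exact: NMn.
by rewrite NegzE mulrNz; exact: stableN sN (NMn _).
Qed.

(* The least positive [m] with [v *~ m] in the union of the chain controls it. *)
Lemma acc_cyclic O v : acc O [set v *~ n | n in [set: int]].
Proof.
move=> N sN NS Nv; have NL := chain_leq NS.
pose C m := `[< (0 < m)%N /\ exists k, N k (v *~ m%:Z) >].
have [exC|noC] := pselect (exists m, C m); last first.
  (* No term of the chain contains a positive multiple of [v] by an integer, so every term is
     zero. *)
  exists 0%N => k w Nw; have [n _ wE] := Nv k w Nw.
  suff -> : w = 0 by exact: stable0 (sN 0%N).
  have nz (m : nat) : N k (v *~ m%:Z) -> v *~ m%:Z = 0.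
    case: m => [|m]; first by rewrite mulr0z.
    by move=> Nm; case: noC; exists m.+1; apply/asboolP; split=> //; exists k.
  rewrite -wE; case: n wE => n wE; first by apply: nz; rewrite wE.
  rewrite NegzE mulrNz nz ?oppr0 //.
  by rewrite -[_ *~ _]opprK -mulrNz -NegzE wE; exact: stableN (sN k) Nw.
have [m /asboolP [m_gt0 [k Nm]] minm] := ex_minnP exC.
exists k => j w Nw; have [n _ wE] := Nv j w Nw.
have mN0 : m%:Z != 0 by rewrite eqz_nat -lt0n.
have vE : v *~ n = v *~ m%:Z *~ (n %/ m%:Z)%Z + v *~ (n %% m%:Z)%Z.
  by rewrite {1}(divz_eq n m%:Z) mulrzDr mulrC mulrzA.
have : (n %% m%:Z)%Z = 0.
  apply/eqP; rewrite -absz_eq0 -leqn0 leqNgt; apply/negP => r_gt0.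
  have rE : (`|(n %% m%:Z)%Z|%N)%:Z = (n %% m%:Z)%Z by rewrite gez0_abs // modz_ge0.
  have : (m <= `|(n %% m%:Z)%Z|)%N.
    apply: minm; apply/asboolP; split=> //; exists (maxn j k).
    have -> : v *~ (`|(n %% m%:Z)%Z|%N)%:Z = v *~ n - v *~ m%:Z *~ (n %/ m%:Z)%Z.
      by rewrite rE vE addrC addKr.
    apply: stableB (sN _) _ _.
      by rewrite wE; exact: NL (leq_maxl _ _) _ Nw.
    by apply: stableMz (sN _) _; exact: NL (leq_maxr _ _) _ Nm.
  by rewrite leqNgt -ltz_nat rE ltz_pmod.
move=> r0; rewrite -wE vE r0 mulr0z addr0.
exact: stableMz (sN k) Nm.
Qed.

(** * Adjoining one operator to a Noetherian module *)

Section Adjoin.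
Variables (O : set I) (y : I) (M : set V).
Hypotheses (nOy : normalizes O y) (sM : stable O M).

Lemma normalizes_iterl n o : O o ->
  exists2 o', O o' & forall v,
    act o (iter n (act y) v) = iter n (act y) (act o' v).
Proof.
elim: n => [|n IHn] /= in o *; first by exists o.
case: nOy => yO _ /yO [o1 /IHn [o' Oo' o'E] o1E]; exists o' => // v.
by rewrite o1E o'E.
Qed.

Lemma normalizes_iterr n o : O o ->
  exists2 o', O o' & forall v,
    iter n (act y) (act o v) = act o' (iter n (act y) v).
Proof.
elim: n => [|n IHn] Oo /=; first by exists o.
have [o1 Oo1 o1E] := IHn Oo.
case: nOy => _ /(_ _ Oo1) [o' Oo' o'E]; exists o' => // v.
by rewrite o1E o'E.
Qed.

Lemma stable_layer n : stable O (layer y M n).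
Proof.
elim: n => //= n IHn; split.
- by exists 0, 0; rewrite -iterS iter_act0 addr0; split=> //; [exact: stable0 IHn|exact: stable0 sM].
- move=> _ _ [u [w [Lu Mw ->]]] [u' [w' [Lu' Mw' ->]]].
  exists (u - u'), (w - w'); split; [exact: stableB IHn _ _|exact: stableB sM _ _|].
  by rewrite -!iterS iter_actB opprD addrACA.
- move=> o _ Oo [u [w [Lu Mw ->]]].
  have [o' Oo' o'E] := normalizes_iterl n.+1 Oo.
  exists (act o u), (act o' w); split; [exact: stable_act IHn _ _|exact: stable_act sM _ _|].
  by rewrite -!iterS -o'E linearD.
Qed.

Lemma layerS n : layer y M n `<=` layer y M n.+1.
Proof.
move=> v Lv; exists v, 0; split=> //; first exact: stable0 sM.
by rewrite iter_act0 addr0.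
Qed.

Lemma layer_leq m n : (m <= n)%N -> layer y M m `<=` layer y M n.
Proof. exact: (chain_leq layerS). Qed.

Lemma layer_act n v : layer y M n v -> layer y M n.+1 (act y v).
Proof.
elim: n v => [|n IHn] v.
  by move=> Mv; exists 0, v; rewrite add0r; split=> //; exact: stable0 sM.
move=> [u [w [Lu Mw ->]]]; exists (act y u), w; split=> //; first exact: IHn.
by rewrite linearD.
Qed.

Lemma stable_adjoin : stable (O `|` [set y]) (adjoin y M).
Proof.
split.
- by exists 0; exact: stable0 sM.
- move=> u v [m Lu] [n Lv]; exists (maxn m n).
  apply: stableB (stable_layer _) _ _.
    by apply: layer_leq Lu; exact: leq_maxl.
  by apply: layer_leq Lv; exact: leq_maxr.
- move=> i v Oi [n Lv]; case: Oi => [Oi|->].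
    by exists n; exact: stable_act (stable_layer n) Oi Lv.
  by exists n.+1; exact: layer_act.
Qed.

Lemma sub_adjoin : M `<=` adjoin y M.
Proof. by move=> v Mv; exists 0%N. Qed.

Lemma layer_scale n : scale_closed M -> scale_closed (layer y M n).
Proof.
move=> JM; elim: n => //= n IHn a _ [u [w [Lu Mw ->]]].
exists (a *: u), (a *: w); split; [exact: IHn|exact: JM|].
by rewrite -!iterS iter_actZ scalerDr.
Qed.

Lemma adjoin_scale : scale_closed M -> scale_closed (adjoin y M).
Proof. by move=> JM a v [n Lv]; exists n; exact: layer_scale. Qed.

(* Leading coefficients, in degree [n.+1], of the elements of [N]. *)
Definition lead N n : set V :=
  [set w | M w /\ exists2 u, layer y M n u & N (u + iter n.+1 (act y) w)].

Lemma stable_lead N n : stable O N -> stable O (lead N n).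
Proof.
move=> sN; split.
- split; first exact: stable0 sM.
  exists 0; first exact: stable0 (stable_layer n).
  by rewrite iter_act0 addr0; exact: stable0 sN.
- move=> w w' [Mw [u Lu Nu]] [Mw' [u' Lu' Nu']].
  split; first exact: stableB sM _ _.
  exists (u - u'); first exact: stableB (stable_layer n) _ _.
  by rewrite iter_actB addrACA -opprD; exact: stableB sN _ _.
- move=> o w Oo [Mw [u Lu Nu]]; split; first exact: stable_act sM _ _.
  have [o' Oo' o'E] := normalizes_iterr n.+1 Oo.
  exists (act o' u); first exact: stable_act (stable_layer n) _ _.
  by rewrite o'E -linearD; exact: stable_act sN _ _.
Qed.

Lemma leadS N N' n : N `<=` N' -> lead N n `<=` lead N' n.
Proof. by move=> NN' w [Mw [u Lu Nu]]; split=> //; exists u => //; exact: NN'. Qed.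

Lemma lead_succ N n : (forall v, N v -> N (act y v)) ->
  lead N n `<=` lead N n.+1.
Proof.
move=> yN w [Mw [u Lu Nu]]; split=> //; exists (act y u); first exact: layer_act.
by rewrite -linearD; exact: yN.
Qed.

(** Induction on the degree: subtracting an element of [N] with the same leading coefficient leaves
    an element of [N'] of lower degree. *)
Lemma lead_sub_eq N N' : stable O N -> N `<=` N' -> stable O N' ->
  N' `&` M `<=` N -> (forall n, lead N' n `<=` lead N n) ->
  N' `&` adjoin y M `<=` N.
Proof.
move=> sN NN' sN' N'M N'L v [N'v [n Lv]].
elim: n => [|n IHn] in v N'v Lv *; first exact: N'M.
case: Lv => u [w [Lu Mw vE]].
have [_ [u' Lu' Nu']] : lead N n w.
  by apply: N'L; split=> //; exists u => //; rewrite -vE.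
have uu'E : v - (u' + iter n.+1 (act y) w) = u - u'.
  by rewrite vE opprD addrACA subrr addr0.
have Nuu' : N (u - u').
  apply: IHn; last exact: stableB (stable_layer n) _ _.
  by rewrite -uu'E; apply: stableB sN' _ _ => //; exact: NN'.
rewrite -(subrK (u' + iter n.+1 (act y) w) v) uu'E.
exact: stableD sN _ _.
Qed.

(* Hilbert's basis theorem, by comparing leading coefficients. *)
Lemma acc_adjoin : acc O M -> acc (O `|` [set y]) (adjoin y M).
Proof.
move=> aM N sN NS NM.
have sON k : stable O (N k).
  by case: (sN k) => N0 NB NA; split=> // i v Oi; apply: NA; left.
have yN k v : N k v -> N k (act y v).
  by apply: (stable_act (sN k)); right.
have NL j k : (j <= k)%N -> N j `<=` N k by exact: chain_leq.
have leadL k m n : (m <= n)%N -> lead (N k) m `<=` lead (N k) n.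
  by apply: chain_leq => ?; apply: lead_succ; exact: yN.
(* The diagonal chain settles all degrees from [i0] on; the finitely many smaller ones are settled
   one at a time by [stab]. *)
have [i0 hi0] : exists i0, forall i, lead (N i) i `<=` lead (N i0) i0.
  apply: aM => [k|k|k]; first exact: stable_lead.
    by apply: (@subset_trans _ (lead (N k.+1) k)); [apply: leadS|exact: leadL].
  by move=> v [].
have stab n : exists j, forall k, lead (N k) n `<=` lead (N j) n.
  apply: aM => [k|k|k]; [exact: stable_lead|exact: leadS|by move=> v []].
have [j hj] := choice stab.
(* Since [lead N n] concerns degree n+1, degree zero needs its own chain. *)
have [j' hj'] : exists j', forall k, N k `&` M `<=` N j' `&` M.
  apply: aM => [k|k v [Nv Mv]|k v []//]; last by split=> //; exact: NS.
  split; first by split; [exact: stable0 (sON k)|exact: stable0 sM].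
    move=> u v [Nu Mu] [Nv Mv].
    by split; [exact: stableB (sON k) _ _|exact: stableB sM _ _].
  move=> i v Oi [Nv Mv].
  by split; [exact: stable_act (sON k) _ _|exact: stable_act sM _ _].
pose k0 := maxn j' (maxn i0 (\max_(n < i0) j n)).
have j'k0 : (j' <= k0)%N by exact: leq_maxl.
have i0k0 : (i0 <= k0)%N by rewrite /k0 maxnCA leq_maxl.
exists k0 => k.
have [kk0|/ltnW k0k] := leqP k k0; first exact: NL.
suff sub : N k `&` adjoin y M `<=` N k0.
  by move=> v Nv; apply: sub; split=> //; exact: NM Nv.
apply: lead_sub_eq => // [|v|n]; first exact: NL.
  by move=> /hj' [Nv _]; exact: NL Nv.
have [ni0|i0n] := ltnP n i0.
  apply: subset_trans (hj n k) _; apply: leadS; apply: NL.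
  rewrite /k0 !leq_max; apply/orP; right; apply/orP; right.
  exact: (leq_bigmax (Ordinal ni0)).
pose m := maxn k n.
apply: (@subset_trans _ (lead (N m) m)).
  apply: (@subset_trans _ (lead (N m) n)); last by apply: leadL; exact: leq_maxr.
  by apply: leadS; apply: NL; exact: leq_maxl.
apply: subset_trans (hi0 m) _.
by apply: (@subset_trans _ (lead (N k0) i0)); [apply: leadS; exact: NL|exact: leadL].
Qed.

End Adjoin.

(** * Divisibility and bounded torsion *)

Section Divisibility.
(* [P] will be the annihilator of [V], a prime ideal of [J]. *)
Variable P : J -> Prop.
Hypotheses (P1 : ~ P 1) (PM : forall a b, P (a * b) -> P a \/ P b).

(** Seen from [M], the element [a] behaves as if it were in the Jacobson radical. *)
Definition divisible (a : J) M : Prop := forall g,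
  ~ P (1 + a * g) /\ forall m, M m -> exists2 v, M v & (1 + a * g) *: v = m.

(** One multiplier bounds the torsion of [M] modulo [X]. Otherwise every candidate [a] misses some
    element killed by some [d], and passing from [a] to [a * d] again and again gives a strictly
    ascending chain. *)
Lemma torsion_bound O M X : acc O M -> stable O M -> stable O X ->
  scale_closed X -> exists2 a, ~ P a &
  forall d w, ~ P d -> M w -> X (d *: w) -> X (a *: w).
Proof.
move=> aM sM sX JX; apply: contrapT => no.
have step a : exists d, ~ P a -> ~ P d /\ exists2 w, M w & X (d *: w) /\ ~ X (a *: w).
  have [Pa|nPa] := pselect (P a); first by exists 1.
  apply: contrapT => nod; apply: no; exists a => // d w nPd Mw Xdw.
  by apply: contrapT => nX; apply: nod; exists d; split=> //; exists w.
have [d hd] := choice step.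
pose a k := iter k (fun b => b * d b) 1.
have aP k : ~ P (a k).
  by elim: k => //= k IHk /PM [//|]; case: (hd _ IHk).
pose Y k := [set w | M w /\ X (a k *: w)].
have [|||k0 hk0] := aM Y.
- move=> k; split.
  + by split; [exact: stable0 sM|rewrite scaler0; exact: stable0 sX].
  + move=> u v [Mu Xu] [Mv Xv]; split; first exact: stableB sM _ _.
    by rewrite scalerBr; exact: stableB sX _ _.
  + move=> o v Oo [Mv Xv]; split; first exact: stable_act sM _ _.
    by rewrite -linearZ; exact: stable_act sX _ _.
- move=> k w [Mw Xw]; split=> //=.
  by rewrite mulrC -scalerA; exact: JX.
- by move=> k w [].
have [_ [w Mw [Xd nX]]] := hd _ (aP k0).
have [|_ //] := hk0 k0.+1 w.
by split=> //=; rewrite -scalerA; exact: JX.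
Qed.

(* If [1 + a g] divides [V] for all [g], then it already divides each layer, as
   [adjoin y M] has bounded torsion over its layers. *)
Lemma divisible_adjoin O y M a : normalizes O y -> stable O M -> acc O M ->
  scale_closed M -> divisible a (adjoin y M) ->
  exists2 b, ~ P b & divisible (a * b) M.
Proof.
move=> nOy sM aM JM dM.
(* The relations in degree n+1: coefficients whose leading term can be rewritten in lower degree.
   They ascend with [n], so one multiplier [b] serves all degrees. *)
pose X n := [set w | M w /\ layer y M n (iter n.+1 (act y) w)].
have sX n : stable O (X n).
  split.
  - by split; [exact: stable0 sM|rewrite iter_act0; exact: stable0 (stable_layer nOy sM n)].
  - move=> u v [Mu Lu] [Mv Lv]; split; first exact: stableB sM _ _.
    by rewrite iter_actB; exact: stableB (stable_layer nOy sM n) _ _.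
  - move=> o v Oo [Mv Lv]; split; first exact: stable_act sM _ _.
    have [o' Oo' ->] := normalizes_iterr nOy n.+1 Oo.
    exact: stable_act (stable_layer nOy sM n) _ _.
have JX n : scale_closed (X n).
  by move=> c v [Mv Lv]; split; [exact: JM|rewrite iter_actZ; exact: layer_scale].
have XS n : X n `<=` X n.+1.
  by move=> w [Mw Lw]; split=> //; exact: (layer_act sM).
have [n0 hn0] : exists n0, forall n, X n `<=` X n0 by apply: aM => // n w [].
have [b nPb hb] : exists2 b, ~ P b & forall n d w, (n <= n0)%N ->
    ~ P d -> M w -> X n (d *: w) -> X n (b *: w).
  elim: (n0) => [|m [b nPb IHm]].
    have [b nPb hb] := torsion_bound aM sM (sX 0%N) (JX 0%N).
    by exists b => // n d w; rewrite leqn0 => /eqP ->; exact: hb.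
  have [c nPc hc] := torsion_bound aM sM (sX m.+1) (JX m.+1).
  exists (b * c) => [/PM [//|//]|n d w].
  rewrite leq_eqVlt => /orP [/eqP -> nPd Mw Xd|nm nPd Mw Xd].
    by rewrite -scalerA; apply: JX; exact: hc Xd.
  by rewrite mulrC -scalerA; apply: JX; exact: IHm Xd.
have hX n d w : ~ P d -> M w -> X n (d *: w) -> X n (b *: w).
  have [nn0|/ltnW n0n] := leqP n n0; first exact: hb.
  move=> nPd Mw /hn0 /(hb _ _ _ (leqnn n0) nPd Mw).
  exact: (chain_leq XS n0n).
exists b => // g; rewrite -mulrA; have [nPs sdiv] := dM (b * g).
split=> // m Mm; have [v [n Lv] sv] := sdiv m (sub_adjoin y Mm).
set s := 1 + _ in nPs sdiv sv *.
suff Mv : M v by exists v.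
(* The top coefficient [w] of [v] is redundant: [s *: w] is in [X n], hence so is [b *: w], and then
   also w = s w - (a g) (b w). This moves [v] down one layer. *)
elim: n => [//|n IHn] in Lv *; apply: IHn.
case: Lv => u [w [Lu Mw vE]].
have Lm : layer y M n m by exact: (layer_leq sM (leq0n n)).
have sL := stable_layer nOy sM n.
have Xsw : X n (s *: w).
  split; first exact: JM.
  rewrite iter_actZ; have -> : s *: iter n.+1 (act y) w = m - s *: u.
    by rewrite -sv vE scalerDr addrC addKr.
  by apply: (stableB sL) => //; exact: layer_scale.
have Xw : X n w.
  have -> : w = s *: w - (a * g) *: (b *: w).
    by rewrite scalerA /s scalerDl scale1r mulrAC mulrA addrK.
  apply: (stableB (sX n)) => //; apply: JX; exact: hX Xsw.
rewrite vE; apply: (stableD sL) => //.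
by case: Xw.
Qed.

End Divisibility.
End OperatorModules.

(** * Finite residue fields *)

Record is_prime_ideal (R : comNzRingType) (P : R -> Prop) : Prop := IsPrimeIdeal {
  prime_ideal0 : P 0;
  prime_idealD : forall a b, P a -> P b -> P (a + b);
  prime_idealMl : forall a b, P b -> P (a * b);
  prime_ideal1 : ~ P 1;
  prime_idealM : forall a b, P (a * b) -> P a \/ P b }.

(** An algebraic extension of the prime field, described through powers of Frobenius. *)
Definition locally_finite_field (p : nat) (K : fieldType) : Prop :=
  p \in [pchar K] /\ forall x : K, exists2 e, (0 < e)%N & x ^+ (p ^ e) = x.

(* The image of [f] is a finite residue field, inside its algebraic closure [K]. *)
Definition finite_residues (R : comNzRingType) : Prop :=
  forall (P : R -> Prop) b, is_prime_ideal P -> ~ P b ->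
  exists (K : closedFieldType) (p : nat) (f : {rmorphism R -> K}),
    [/\ locally_finite_field p K, forall r, P r -> f r = 0, f b != 0
      & exists2 e, (0 < e)%N & forall r, f r ^+ (p ^ e) = f r].

(** * Frobenius powers and residue fields of the integers *)

Section FrobeniusFixed.
Variables (p : nat) (K : fieldType).
Hypothesis charKp : p \in [pchar K].
Implicit Types x y : K.

Let pX e : [pchar K].-nat (p ^ e)%N.
Proof.
by rewrite (eq_pnat _ (pcharf_eq charKp)) pnatX pnat_id // (pcharf_prime charKp).
Qed.

Lemma pchar_expr_inj e : injective (fun x => x ^+ (p ^ e)).
Proof.
move=> x y xy; apply/eqP; rewrite -subr_eq0.
have : (x - y) ^+ (p ^ e) == 0 by rewrite exprDn_pchar // exprNn_pchar // xy subrr.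
by rewrite expf_eq0 => /andP [].
Qed.

Lemma pchar_expr_root e (q : {poly K}) x :
  (forall i, q`_i ^+ (p ^ e) = q`_i) -> root q x -> root q (x ^+ (p ^ e)).
Proof.
move=> qE /rootP qx; apply/rootP.
have p_gt0 : (0 < p ^ e)%N by rewrite expn_gt0 prime_gt0 // (pcharf_prime charKp).
rewrite -[RHS](_ : 0 ^+ (p ^ e) = 0); last by rewrite expr0n gtn_eqF.
rewrite -qx !horner_coef.
elim/big_rec2: _ => [|i a b _ ->]; first by rewrite expr0n gtn_eqF.
by rewrite exprDn_pchar // exprMn qE exprAC.
Qed.

Lemma pchar_expr_mul e k x : x ^+ (p ^ e) = x -> x ^+ (p ^ (e * k)) = x.
Proof.
by move=> xe; elim: k => [|k IHk]; rewrite ?muln0 // mulnS expnD exprM xe.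
Qed.

(** The Frobenius orbit of [x] stays among the finitely many roots of [q], so it repeats;
    injectivity of Frobenius makes it return to [x] itself. *)
Lemma algebraic_expr_fixed (q : {poly K}) x : q != 0 ->
  (forall i, q`_i ^+ p = q`_i) -> root q x ->
  exists2 e, (0 < e)%N & x ^+ (p ^ e) = x.
Proof.
move=> q0 qE qx.
have qrt i : root q (x ^+ (p ^ i)).
  elim: i => [|i IHi]; first by rewrite expr1.
  by rewrite expnSr exprM -[p in _ ^+ p]expn1; apply: pchar_expr_root => // j; rewrite expn1.
pose rs := [seq x ^+ (p ^ i) | i <- iota 0 (size q)].
have : ~~ uniq rs.
  have qrs : all (root q) rs by apply/allP => _ /mapP [i _ ->].
  by apply/negP => /(max_poly_roots q0 qrs); rewrite size_map size_iota ltnn.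
move/(uniqPn 0) => [i [j [ij js]]].
rewrite size_map size_iota in js.
have is_ := ltn_trans ij js.
rewrite !(nth_map 0%N) ?size_iota // !nth_iota // !add0n => eij.
exists (j - i)%N; first by rewrite subn_gt0.
apply: (@pchar_expr_inj i); rewrite /= -exprM -expnD subnK //.
exact: ltnW.
Qed.

End FrobeniusFixed.

Lemma prime_field_closure (p : nat) : prime p ->
  exists K : closedFieldType, locally_finite_field p K.
Proof.
move=> p_pr; have [K [f intK]] := countable_algebraic_closure 'F_p.
have chK : p \in [pchar K] by rewrite (fmorph_pchar f) pchar_Fp.
exists K; split=> // x; have [q mq qx] := intK x.
apply: (algebraic_expr_fixed chK _ _ qx) => [|i].
  by rewrite map_poly_eq0 monic_neq0.
rewrite coef_map -rmorphXn /=; congr (f _).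
by apply/eqP; rewrite -[X in _ ^+ X](card_Fp p_pr) expf_card.
Qed.

Lemma prime_idealX (R : comNzRingType) (P : R -> Prop) a k :
  is_prime_ideal P -> P (a ^+ k) -> P a.
Proof.
move=> pP; elim: k => [/(prime_ideal1 pP)//|k IHk].
by rewrite exprS => /(prime_idealM pP) [].
Qed.

Lemma prime_idealN (R : comNzRingType) (P : R -> Prop) a :
  is_prime_ideal P -> P a -> P (- a).
Proof. by move=> pP Pa; rewrite -mulN1r; exact: (prime_idealMl pP). Qed.

(** Either [P] contains a positive integer, hence a prime, by factoring; or P = 0, and any prime
    larger than the absolute value of [b] will do. *)
Lemma finite_residues_int : finite_residues int.
Proof.
move=> P b pP nPb.
have [p p_pr [Pp npb]] : exists2 p : nat, prime p &
    (forall r, P r -> (p %| r)%Z) /\ ~~ (p %| b)%Z.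
  have [[n [n_gt0 Pn]]|no] := pselect (exists n : nat, (0 < n)%N /\ P n%:Z).
    have [p p_pr Pp] : exists2 p : nat, prime p & P p%:Z.
      have [m] := ubnP n; elim: m n n_gt0 Pn => // m IHm n n_gt0 Pn nm.
      have [n1|n_gt1] := leqP n 1.
        by have n1E : n = 1%N by [apply/eqP; rewrite eqn_leq n1]; case: (prime_ideal1 pP); rewrite n1E in Pn.
      have := pdiv_dvd n => /divnK nE; move: (Pn); rewrite -nE PoszM.
      move=> /(prime_idealM pP) [Pd|Pp]; last by exists (pdiv n) => //; exact: pdiv_prime.
      have d_lt : (n %/ pdiv n < n)%N by rewrite ltn_Pdiv // prime_gt1 // pdiv_prime.
      apply: IHm Pd _; last exact: leq_trans d_lt nm.
      by rewrite divn_gt0 ?pdiv_gt0 // dvdn_leq // pdiv_dvd.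
    exists p => //; split=> [r Pr|].
      apply/contraT => npr; case: (prime_ideal1 pP).
      have /coprimezP [[u v] /= <-] : coprimez p r.
        by rewrite coprimezE /= prime_coprime.
      by apply: prime_idealD => //; exact: (prime_idealMl pP).
    by apply/negP => /dvdzP [q bE]; apply: nPb; rewrite bE; exact: (prime_idealMl pP).
  have P0 r : P r -> r = 0.
    move=> Pr; apply/eqP; rewrite -absz_eq0 -leqn0 leqNgt; apply/negP => r_gt0.
    apply: no; exists `|r|%N; split=> //.
    by case: r Pr {r_gt0} => n //= /(prime_idealN pP); rewrite NegzE opprK.
  have [p bp p_pr] := prime_above `|b|.
  exists p => //; split=> [r /P0 ->|]; first exact: dvdz0.
  have b_gt0 : (0 < `|b|)%N.
    by rewrite absz_gt0; apply/eqP => b0; apply: nPb; rewrite b0; exact: (prime_ideal0 pP).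
  by apply/negP => pb; have : (p <= `|b|)%N := dvdn_leq b_gt0 pb; rewrite leqNgt bp.
have [K lK] := prime_field_closure p_pr.
have [chK _] := lK.
have intK (r : int) : ((r%:~R : K) == 0) = (p %| r)%Z.
  by case: r => n; rewrite ?NegzE ?rmorphN ?oppr_eq0 /dvdz /= ?abszN -(dvdn_pcharf chK).
exists K, p, (intmul 1); split=> //.
- by move=> r /Pp; rewrite -intK => /eqP.
- by rewrite intK.
exists 1%N => // r; rewrite expn1.
have nat_fix n : (n%:R : K) ^+ p = n%:R.
  by rewrite -(pFrobenius_autE chK) pFrobenius_aut_nat.
case: r => n; first exact: nat_fix.
rewrite NegzE rmorphN exprNn_pchar ?nat_fix //.
by rewrite (eq_pnat _ (pcharf_eq chK)) pnat_id.
Qed.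

(** * Residue fields of polynomial rings *)

Section PolynomialExtension.
Variables (R : comNzRingType) (P : {poly R} -> Prop).
Hypothesis pP : is_prime_ideal P.
Implicit Types (g h q d : {poly R}) (S : {poly R} -> Prop).

(** [P0] is the contraction of [P] to the coefficients, and [inP0] the extension of [P0] back to
    polynomials. *)
Let P0 (c : R) := P c%:P.
Let inP0 g := forall i, P0 g`_i.

Lemma contracted_prime_ideal : is_prime_ideal P0.
Proof.
split; rewrite /P0.
- exact: (prime_ideal0 pP).
- by move=> a b Pa Pb; rewrite polyCD; exact: (prime_idealD pP).
- by move=> a b Pb; rewrite polyCM; exact: (prime_idealMl pP).
- by rewrite polyC1; exact: (prime_ideal1 pP).
- by move=> a b; rewrite polyCM; exact: (prime_idealM pP).
Qed.
Let pP0 := contracted_prime_ideal.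

Lemma inP0_sub g : inP0 g -> P g.
Proof.
move=> gP; rewrite -[g]coefK poly_def; elim/big_ind: _ => [|x y|i _].
- exact: (prime_ideal0 pP).
- exact: (prime_idealD pP).
- by rewrite -mul_polyC mulrC; exact: (prime_idealMl pP _ (gP i)).
Qed.

Lemma inP0M g h : inP0 h -> inP0 (g * h).
Proof.
move=> hP i; rewrite coefM; elim/big_ind: _ => [|x y|j _].
- exact: (prime_ideal0 pP0).
- exact: (prime_idealD pP0).
- exact: (prime_idealMl pP0).
Qed.

Lemma inP0D g h : inP0 g -> inP0 h -> inP0 (g + h).
Proof. by move=> gP hP i; rewrite coefD; exact: (prime_idealD pP0). Qed.

Lemma trim_leading g : ~ inP0 g ->
  exists h, [/\ inP0 (g - h), ~ P0 (lead_coef h) & (size h <= size g)%N].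
Proof.
have [m] := ubnP (size g); elim: m g => // m IHm g gm ngP.
have [Pl|nPl] := pselect (P0 (lead_coef g)); last first.
  by exists g; split=> // i; rewrite subrr coef0; exact: (prime_ideal0 pP).
have g0 : g != 0.
  by apply/eqP => g0; apply: ngP => i; rewrite g0 coef0; exact: (prime_ideal0 pP).
have sg := polySpred g0; pose t : {poly R} := lead_coef g *: 'X^((size g).-1).
have tP : inP0 t.
  move=> i; rewrite coefZ mulrC; exact: (prime_idealMl pP0).
have sgt : (size (g - t)%R < size g)%N.
  rewrite sg ltnS.
  apply/leq_sizeP => j; rewrite leq_eqVlt => /orP [/eqP <-|jg].
    by rewrite coefB coefZ coefXn eqxx mulr1 subrr.
  rewrite coefB coefZ coefXn gtn_eqF // mulr0 subr0 nth_default //.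
  by rewrite sg.
have [||h [hP nPh sh]] := IHm (g - t).
- exact: leq_trans sgt gm.
- by move=> gtP; apply: ngP; rewrite -(subrK t g); exact: inP0D.
exists h; split=> //; last exact: leq_trans sh (ltnW sgt).
by rewrite -(subrK t g) addrAC; exact: inP0D.
Qed.

(** Modulo [P0] this picks a nonzero element of least degree; trimming first ensures that the
    leading coefficient survives modulo [P0]. *)
Lemma least_degree S : (forall g h, S g -> inP0 h -> S (g - h)) ->
  (exists2 g, S g & ~ inP0 g) ->
  exists d, [/\ S d, ~ P0 (lead_coef d)
    & forall h, S h -> (size h < size d)%N -> inP0 h].
Proof.
move=> SB [g Sg ngP].
have trim h : S h -> ~ inP0 h ->
    exists h', [/\ S h', ~ P0 (lead_coef h') & (size h' <= size h)%N].
  move=> Sh /trim_leading [h' [hh' nP sh]]; exists h'; split=> //.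
  by rewrite -(subKr h h'); exact: SB.
pose C n := `[< exists d, [/\ S d, ~ P0 (lead_coef d) & size d = n] >].
have exC : exists n, C n.
  by have [d [Sd nPd _]] := trim g Sg ngP; exists (size d); apply/asboolP; exists d.
have [n /asboolP [d [Sd nPd sd]] minn] := ex_minnP exC.
exists d; split=> // h Sh hd; apply: contrapT => nhP.
have [h' [Sh' nPh' sh']] := trim h Sh nhP.
have : (n <= size h')%N by apply: minn; apply/asboolP; exists h'.
by rewrite -sd leqNgt (leq_ltn_trans sh' hd).
Qed.

Lemma pseudo_division g d : ~ P0 (lead_coef d) ->
  exists k q r, lead_coef d ^+ k *: g = q * d + r /\ (size r < size d)%N.
Proof.
move=> nPd; have d0 : d != 0.
  by apply/eqP => d0; apply: nPd; rewrite d0 lead_coef0; exact: (prime_ideal0 pP).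
case: (Pdiv.ComRing.redivpP g d) => k q r gE /(_ d0) rd.
by exists k, q, r.
Qed.

(** Over the fraction field of [R] modulo [P0], the ideal [P] is generated by [d] and maximal, so
    [b] is invertible modulo it; [c] is a cleared denominator. The proof avoids fractions by taking
    [e] of least degree in the ideal generated by [P] and [b]. *)
Lemma generic_bezout d b : P d -> ~ P0 (lead_coef d) ->
  (forall h, P h -> (size h < size d)%N -> inP0 h) -> ~ P b ->
  exists c u, ~ P0 c /\ P (c%:P - u * b).
Proof.
move=> Pd nPd dmin nPb.
pose S g := exists u, P (g - u * b).
have SP g : P g -> S g by move=> Pg; exists 0; rewrite mul0r subr0.
have SB g h : S g -> P h -> S (g - h).
  move=> [u Pg] Ph; exists u; rewrite addrAC.
  by apply: (prime_idealD pP) => //; exact: (prime_idealN pP).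
have [|e [Se nPe emin]] := @least_degree S (fun g h Sg hP => SB g h Sg (inP0_sub hP)).
  by exists b => [|/inP0_sub//]; exists 1; rewrite mul1r subrr; exact: (prime_ideal0 pP).
have SM q g : S g -> S (q * g).
  move=> [u Pg]; exists (q * u); rewrite -mulrA -mulrBr; exact: (prime_idealMl pP).
have [e1|e_gt1] := leqP (size e) 1.
  have eE : e = (e`_0)%:P by exact: size1_polyC.
  move: Se nPe; rewrite eE lead_coefC => -[u Pu] nPe.
  by exists e`_0, u.
have [ede|nde] := pselect (P e).
  (* If [e] were in [P], then [d] would be no longer than [e], the remainder of [b] by [d] would
     vanish modulo [P0], and [b] would lie in [P]. *)
  have [k [q [r [bE rs]]]] := pseudo_division b nPd.
  have de : (size d <= size e)%N.
    rewrite leqNgt; apply/negP => ed; apply: nPe; exact: dmin ede ed _.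
  have rP : inP0 r.
    apply: emin (leq_trans rs de).
    have -> : r = (lead_coef d ^+ k)%:P * b - q * d.
      by rewrite mul_polyC bE addrC addKr.
    apply: SB; last exact: (prime_idealMl pP).
    by exists (lead_coef d ^+ k)%:P; rewrite subrr; exact: (prime_ideal0 pP).
  have : P ((lead_coef d ^+ k)%:P * b).
    rewrite mul_polyC bE; apply: (prime_idealD pP); first exact: (prime_idealMl pP).
    exact: inP0_sub.
  by move=> /(prime_idealM pP) [/(prime_idealX pP0)|].
(* Here [e] is outside [P] and not constant. Modulo [P0], a scalar multiple of [d] equals [q * e],
   so [q] lies in [P] and has at least the degree of [d]; then [q * e] has too large a degree. *)
have [k [q [r [dE rs]]]] := pseudo_division d nPe.
have rP : inP0 r.
  apply: emin rs; have -> : r = (lead_coef e ^+ k)%:P * d - q * e.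
    by rewrite mul_polyC dE addrC addKr.
  rewrite -mulNr addrC.
  have [u Pu] := SM (- q) e Se; exists u.
  rewrite addrAC; apply: (prime_idealD pP) => //; exact: (prime_idealMl pP).
have Pq : P q.
  have : P (q * e).
    have -> : q * e = (lead_coef e ^+ k)%:P * d - r by rewrite mul_polyC dE addrK.
    apply: (prime_idealD pP); first exact: (prime_idealMl pP).
    by apply: (prime_idealN pP); exact: inP0_sub.
  by move=> /(prime_idealM pP) [].
have [qP|nqP] := pselect (inP0 q).
  case: nPd; have := inP0D (inP0M e qP) rP; rewrite mulrC -dE.
  move=> /(_ (size d).-1); rewrite coefZ => /(prime_idealM pP0) [|//].
  by move=> /(prime_idealX pP0).
have [q' [qq' nPq' _]] := trim_leading nqP.
have Pq' : P q'.
  rewrite -(subKr q q'); apply: (prime_idealD pP) => //.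
  by apply: (prime_idealN pP); exact: inP0_sub.
have dq' : (size d <= size q')%N.
  by rewrite leqNgt; apply/negP => q'd; apply: nPq'; exact: dmin Pq' q'd _.
have nPl : ~ P0 (lead_coef q' * lead_coef e) by move=> /(prime_idealM pP0) [].
have l0 : lead_coef q' * lead_coef e != 0.
  by apply/eqP => l0; apply: nPl; rewrite l0; exact: (prime_ideal0 pP0).
case: nPl; rewrite -lead_coef_proper_mul // /lead_coef size_proper_mul //.
have -> : q' * e = lead_coef e ^+ k *: d - r - (q - q') * e.
  by rewrite dE addrK mulrBl subKr.
have e_gt0 : (0 < size e)%N by exact: ltnW.
have d_lt : (size d <= (size q' + size e).-1.-1)%N.
  apply: leq_trans dq' _; case: (size e) e_gt1 => [|[|s]] // _.
  by rewrite !addnS /= leq_addr.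
(* [n] is the degree of [q' * e]. Neither [d] nor [r] reaches it, so the coefficient comes from
   [(q - q') * e] and lies in [P0]. *)
set n := (size q' + size e).-1.-1 in d_lt *.
rewrite !coefB coefZ [d`_n]nth_default // mulr0 sub0r.
have er : (size e <= size d)%N.
  rewrite leqNgt; apply/negP => de; apply: nPd; exact: emin (SP d Pd) de _.
rewrite [r`_n]nth_default ?oppr0 ?sub0r; last first.
  exact: leq_trans (ltnW rs) (leq_trans er d_lt).
by apply: (prime_idealN pP0); rewrite mulrC; exact: inP0M.
Qed.

End PolynomialExtension.

Section HornerResidue.
Variables (R : comNzRingType) (K : closedFieldType) (f : {rmorphism R -> K}).

Lemma eval_commutes (x : K) : commr_rmorph f x.
Proof. by move=> c; exact: mulrC. Qed.

Definition residue_eval (x : K) : {rmorphism {poly R} -> K} :=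
  horner_morph (eval_commutes x).

Lemma residue_evalE x g : residue_eval x g = (map_poly f g).[x].
Proof. by []. Qed.

Lemma residue_eval_fixed p e x : locally_finite_field p K ->
  (0 < e)%N -> (forall r, f r ^+ (p ^ e) = f r) ->
  exists2 e', (0 < e')%N & forall g, residue_eval x g ^+ (p ^ e') = residue_eval x g.
Proof.
move=> [chK locK] e_gt0 fe; have [k k_gt0 xk] := locK x.
(* A common multiple of the exponents that fix the image of [R] and the point [x]. *)
exists (e * k)%N => [|g]; first by rewrite muln_gt0 e_gt0.
have xE : x ^+ (p ^ (e * k)) = x by rewrite mulnC; exact: pchar_expr_mul.
have fE r : f r ^+ (p ^ (e * k)) = f r by exact: pchar_expr_mul.
have pX : [pchar K].-nat (p ^ (e * k))%N.
  by rewrite (eq_pnat _ (pcharf_eq chK)) pnatX pnat_id // (pcharf_prime chK).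
elim/poly_ind: g => [|g c IHg].
  by rewrite rmorph0 expr0n gtn_eqF // expn_gt0 prime_gt0 // (pcharf_prime chK).
rewrite rmorphD rmorphM exprDn_pchar // exprMn IHg /= horner_morphX horner_morphC.
by rewrite xE fE.
Qed.

End HornerResidue.

(** If [P] is extended from the coefficients, evaluate at a point where the reduction of [b] is
    nonzero. Otherwise evaluate at a root of the reduction of [d]: as [lead_coef d] survives,
    pseudo-division kills [P]; as the constant [c] of [generic_bezout] survives, so does [b]. *)
Lemma finite_residues_poly (R : comNzRingType) :
  finite_residues R -> finite_residues {poly R}.
Proof.
move=> frR P b pP nPb.
pose P0 c := P c%:P; pose inP0 (g : {poly R}) := forall i, P0 g`_i.
have pP0 : is_prime_ideal P0 := contracted_prime_ideal pP.
have [ext|/contrapT next] := pselect (~ exists2 g, P g & ~ inP0 g).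
  have {}ext g : P g -> inP0 g.
    by move=> Pg; apply: contrapT => ng; apply: ext; exists g.
  have [i nPi] : exists i, ~ P0 b`_i.
    apply: contrapT => no; apply: nPb; apply: (inP0_sub pP) => i.
    by apply: contrapT => nPi; apply: no; exists i.
  have [K [p [f [lK fP fb [e e_gt0 fe]]]]] := frR P0 _ pP0 nPi.
  have fb0 : map_poly f b != 0.
    by apply: contraNneq fb => fb0; rewrite -coef_map fb0 coef0.
  have /closed_nonrootP [x nbx] := fb0.
  exists K, p, (residue_eval f x); split=> // [g /ext gP|].
    rewrite residue_evalE (_ : map_poly f g = 0) ?horner0 //.
    by apply/polyP => j; rewrite coef_map coef0; exact: fP.
  exact: residue_eval_fixed fe.
have [d [Pd nPd dmin]] := @least_degree R P pP P
  (fun g h Pg hP => prime_idealD pP Pg (prime_idealN pP (inP0_sub pP hP))) next.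
have [c [u [nPc Pcub]]] := generic_bezout pP Pd nPd dmin nPb.
have nPdc : ~ P0 (lead_coef d * c) by move=> /(prime_idealM pP0) [].
have [K [p [f [lK fP fdc [e e_gt0 fe]]]]] := frR P0 _ pP0 nPdc.
move: fdc; rewrite rmorphM mulf_eq0 negb_or => /andP [fd fc].
have sd : size (map_poly f d) = size d by exact: size_poly_eq.
have /closed_rootP [x /rootP dx] : size (map_poly f d) != 1%N.
  rewrite sd; apply/negP => /size_poly1P [a a0 dE].
  by apply: nPd; rewrite dE lead_coefC /P0 -dE.
have evP g : P g -> residue_eval f x g = 0.
  move=> Pg; have [k [q [r [gE rd]]]] := pseudo_division pP g nPd.
  have rP : inP0 r.
    apply: dmin rd; have -> : r = (lead_coef d ^+ k)%:P * g - q * d.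
      by rewrite mul_polyC gE addrC addKr.
    apply: (prime_idealD pP); first exact: (prime_idealMl pP).
    by apply: (prime_idealN pP); exact: (prime_idealMl pP).
  have ev_r : residue_eval f x r = 0.
    rewrite residue_evalE (_ : map_poly f r = 0) ?horner0 //.
    by apply/polyP => j; rewrite coef_map coef0; exact: fP.
  have ev_d : residue_eval f x d = 0 by rewrite residue_evalE.
  have := congr1 (residue_eval f x) gE.
  rewrite -mul_polyC rmorphM rmorphD rmorphM ev_r ev_d mulr0 addr0 => /eqP.
  rewrite mulf_eq0 => /orP [|/eqP //].
  by rewrite /= horner_morphC rmorphXn expf_eq0 (negbTE fd) andbF.
exists K, p, (residue_eval f x); split=> //.
  have := evP _ Pcub; rewrite rmorphB rmorphM => /eqP; rewrite subr_eq0 => /eqP cE.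
  apply: contraNneq fc => b0; move: cE; rewrite b0 mulr0 /= horner_morphC.
  by move/eqP.
exact: residue_eval_fixed fe.
Qed.

(** [R] is the ring of integers with one polynomial variable adjoined for each entry of [s]. *)
Lemma finite_residues_cover (F : fieldType) (s : seq F) :
  exists (R : comNzRingType) (h : {rmorphism R -> F}),
    finite_residues R /\ forall x, x \in s -> exists r, h r = x.
Proof.
elim: s => [|x s [R [h [frR hs]]]].
  by exists int, (intmul 1); split=> //; exact: finite_residues_int.
have cx : commr_rmorph h x by move=> c; exact: mulrC.
exists {poly R}, (horner_morph cx); split; first exact: finite_residues_poly.
move=> y; rewrite inE => /orP [/eqP ->|/hs [r <-]].
  by exists 'X; rewrite /= horner_morphX.
by exists r%:P; rewrite /= horner_morphC.
Qed.

(** * Modules over integer polynomials *)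

(* [V] as a module over [Z[X]], with [X] acting as [z]. *)
Definition poly_module (V : zmodType) (z : {additive V -> V}) : Type := V.

Section PolyModule.
Variables (V : zmodType) (z : {additive V -> V}).
Implicit Types (p q : {poly int}) (u v : V).

HB.instance Definition _ := GRing.Zmodule.on (poly_module z).

Definition poly_scale p v : V := \sum_(i < size p) iter i z v *~ p`_i.

Lemma poly_scale_widen n p v : (size p <= n)%N ->
  poly_scale p v = \sum_(i < n) iter i z v *~ p`_i.
Proof.
move=> pn; rewrite /poly_scale (big_ord_widen n (fun i => iter i z v *~ p`_i)) //.
rewrite big_mkcond /=; apply: eq_bigr => i _.
by case: ltnP => // pi; rewrite nth_default // mulr0z.
Qed.

Lemma iter_additiveD n u v : iter n z (u + v) = iter n z u + iter n z v.
Proof. by elim: n => //= n ->; rewrite raddfD. Qed.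

Lemma poly_scaleDr p u v : poly_scale p (u + v) = poly_scale p u + poly_scale p v.
Proof.
rewrite /poly_scale -big_split; apply: eq_bigr => i _.
by rewrite iter_additiveD mulrzDl.
Qed.

Lemma poly_scaleDl p q v : poly_scale (p + q) v = poly_scale p v + poly_scale q v.
Proof.
pose n := maxn (size p) (size q).
rewrite (@poly_scale_widen n p) ?leq_maxl // (@poly_scale_widen n q) ?leq_maxr //.
rewrite (@poly_scale_widen n) ?size_polyD // -big_split; apply: eq_bigr => i _.
by rewrite coefD mulrzDr.
Qed.

Lemma poly_scaleC c v : poly_scale c%:P v = v *~ c.
Proof.
by rewrite (@poly_scale_widen 1) ?size_polyC ?leq_b1 // big_ord1 /= coefC.
Qed.

Lemma poly_scaleMX p v : poly_scale (p * 'X) v = poly_scale p (z v).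
Proof.
rewrite (@poly_scale_widen (size p).+1); last first.
  by rewrite (leq_trans (size_polyMleq _ _)) // size_polyX addn2.
rewrite big_ord_recl /= coefMX eqxx mulr0z add0r; apply: eq_bigr => i _.
by rewrite coefMX /= -iterSr.
Qed.

Lemma poly_scale_comm p (w : {additive V -> V}) v :
  (forall u, w (z u) = z (w u)) -> poly_scale p (w v) = w (poly_scale p v).
Proof.
move=> wz; rewrite /poly_scale raddf_sum; apply: eq_bigr => i _.
by rewrite raddfMz; congr (_ *~ _); elim: (nat_of_ord i) => //= k ->; rewrite wz.
Qed.

Lemma poly_scaleA p q v : poly_scale p (poly_scale q v) = poly_scale (p * q) v.
Proof.
elim/poly_ind: p => [|p c IHp] in q v *.
  by rewrite mul0r /poly_scale !size_poly0 !big_ord0.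
rewrite mulrDl !poly_scaleDl -mulrA -(commr_polyX q) mulrA !poly_scaleMX -IHp.
rewrite (@poly_scale_comm q z v) // poly_scaleC; congr (_ + _).
rewrite mul_polyC (@poly_scale_widen (size q) (c *: q)) ?size_scale_leq // /poly_scale.
rewrite mulrz_suml; apply: eq_bigr => i _.
by rewrite coefZ mulrC mulrzA.
Qed.

Lemma poly_scale1 v : poly_scale 1 v = v.
Proof. by rewrite -polyC1 poly_scaleC. Qed.

HB.instance Definition _ := GRing.Zmodule_isLmodule.Build {poly int} (poly_module z)
  poly_scaleA poly_scale1 poly_scaleDr (fun v p q => poly_scaleDl p q v).

End PolyModule.

Section PolyLinear.
Variables (V : zmodType) (z w : {additive V -> V}).
Hypothesis wz : forall u, w (z u) = z (w u).

Definition poly_linear_fun : poly_module z -> poly_module z := w.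

Lemma poly_linear_additive : additive poly_linear_fun.
Proof. exact: raddfB. Qed.

Lemma poly_linear_scalable : scalable poly_linear_fun.
Proof. by move=> p v; rewrite /poly_linear_fun -(poly_scale_comm p v wz). Qed.

HB.instance Definition _ :=
  GRing.isAdditive.Build (poly_module z) (poly_module z) poly_linear_fun
    poly_linear_additive.
HB.instance Definition _ :=
  GRing.isScalable.Build {poly int} (poly_module z) (poly_module z) *:%R
    poly_linear_fun poly_linear_scalable.

Definition poly_linear : {linear poly_module z -> poly_module z} := poly_linear_fun.

End PolyLinear.

(** * Just non-nilpotent groups *)

Local Open Scope group_scope.

Section AbelianNormal.
Variables (G : groupType) (N : normalSubgroup G) (abN : is_abelian (ns_set N)).

(** The commutativity proof is a parameter of the type, so that the additive group structure can be
    attached to it. *)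
Definition additive_of & is_abelian (ns_set N) : Type := {x : G | `[< ns_set N x >]}.
Local Notation V := (additive_of abN).

HB.instance Definition _ := Choice.on V.
HB.instance Definition _ := SubType.on V.

Definition add_of (x : G) (Nx : ns_set N x) : V := Sub x (asboolT Nx).

Lemma add_ofP (v : V) : ns_set N (val v).
Proof. by case: v => x /= /asboolP. Qed.

Definition vadd (u v : V) : V := add_of (nsM (add_ofP u) (add_ofP v)).
Definition vopp (u : V) : V := add_of (nsV (add_ofP u)).
Definition vzero : V := add_of (ns1 N).

Lemma vaddA : associative vadd.
Proof. by move=> u v w; apply: val_inj; rewrite /= mulgA. Qed.

Lemma vaddC : commutative vadd.
Proof. by move=> u v; apply: val_inj; apply: abN; exact: add_ofP. Qed.

Lemma vadd0 : left_id vzero vadd.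
Proof. by move=> u; apply: val_inj; rewrite /= mul1g. Qed.

Lemma vaddN : left_inverse vzero vopp vadd.
Proof. by move=> u; apply: val_inj; rewrite /= mulVg. Qed.

HB.instance Definition _ := GRing.isZmodule.Build V vaddA vaddC vadd0 vaddN.

Lemma valD (u v : V) : val (u + v)%R = val u * val v.
Proof. by []. Qed.

Lemma valN (u : V) : val (- u)%R = (val u)^-1.
Proof. by []. Qed.

Lemma val0 : val (0%R : V) = 1.
Proof. by []. Qed.

Lemma valB (u v : V) : val (u - v)%R = val u / val v.
Proof. by []. Qed.

Lemma valMz (v : V) n : val (v *~ n)%R = expgz (val v) n.
Proof.
have valMn k : val (v *+ k)%R = val v ^+ k.
  by elim: k => [|k IHk]; rewrite ?mulr0n // mulrS valD IHk expgS.
by case: n => k; [exact: valMn|rewrite NegzE mulrNz valN valMn].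
Qed.

Definition vconj (g : G) (v : V) : V := add_of (nsJ g (add_ofP v)).

Lemma val_vconj g v : val (vconj g v) = val v ^ g.
Proof. by []. Qed.

Lemma vconj_additive g : additive (vconj g).
Proof. by move=> u v; apply: val_inj; rewrite /= conjMg conjVg. Qed.

HB.instance Definition _ g := GRing.isAdditive.Build V V (vconj g) (vconj_additive g).

Lemma vconjM g h v : vconj (g * h) v = vconj h (vconj g v).
Proof. by apply: val_inj; rewrite /= conjgM. Qed.

Lemma vconj1 v : vconj 1 v = v.
Proof. by apply: val_inj; rewrite /= conjg1. Qed.

End AbelianNormal.

(** * Elements of normal closures as values of words *)

Section NormalClosure.
Variable G : groupType.
Implicit Types (x g : G).

Definition normal_closure (b : G) : set G := gen_subgroup [set b ^ g | g in setT].

Lemma normal_closure_normal b : is_normal (normal_closure b).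
Proof.
apply: gen_subgroup_normal => _ g [h _ <-].
by exists (h * g) => //; rewrite conjgM.
Qed.

Lemma mem_normal_closure b : normal_closure b b.
Proof. by apply: sub_gen_subgroup; exists 1 => //; exact: conjg1. Qed.

Lemma normal_closure_min b K : is_normal K -> K b -> normal_closure b `<=` K.
Proof.
move=> nK Kb x /(_ K); apply; first by case: nK.
by move=> _ [g _ <-]; exact: normalJ.
Qed.

(** Replace [b] by the unknown in a product of conjugates of [b] and [b^-1]. *)
Lemma normal_closure_word b x : normal_closure b x ->
  exists e f, [/\ word_map e f, f 1 = 1 & f b = x].
Proof.
move=> /(_ [set y | exists e f, [/\ word_map e f, f 1 = 1 & f b = y]]).
apply; last first.
  move=> _ [g _ <-]; exists 1%R, (fun x => x ^ g); split=> //; last exact: conj1g.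
  exact/word_mapJ/word_map_id.
split=> [|u v [d [f [wf f1 fb]]] [e [h [wh h1 hb]]]|u [e [f [wf f1 fb]]]].
- by exists 0%R, (fun=> 1); split=> //; exact: word_map_const.
- exists (d + e)%R, (fun x => f x * h x); split; first exact: word_mapM.
    by rewrite f1 h1 mulg1.
  by rewrite fb hb.
- exists (- e)%R, (fun x => (f x)^-1); split; first exact: word_mapV.
    by rewrite f1 invg1.
  by rewrite fb.
Qed.

Lemma normal_closure_comm_word b x : comm_subgroup (normal_closure b) setT x ->
  exists f, [/\ word_map 0 f, f 1 = 1 & f b = x].
Proof.
move=> /(_ [set y | exists f, [/\ word_map 0 f, f 1 = 1 & f b = y]]).
apply; last first.
  move=> _ [y /normal_closure_word [e [f [wf f1 fb]]] [g _ <-]].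
  exists (fun x => [~ f x, g]); split; first exact: word_mapR wf.
    by rewrite f1 comm1g.
  by rewrite fb.
split=> [|u v [f [wf f1 fb]] [h [wh h1 hb]]|u [f [wf f1 fb]]].
- by exists (fun=> 1); split=> //; exact: word_map_const.
- exists (fun x => f x * h x); split; first by rewrite -[0%R]addr0; exact: word_mapM.
    by rewrite f1 h1 mulg1.
  by rewrite fb hb.
- exists (fun x => (f x)^-1); split; first by rewrite -oppr0; exact: word_mapV.
    by rewrite f1 invg1.
  by rewrite fb.
Qed.

End NormalClosure.

(** * Just non-nilpotent groups: center and finite normal subgroups *)

Section JustNonNilpotent.
Variables (G : groupType) (s : seq G).
Hypothesis gens : gen_subgroup [set` s] = setT.
Hypothesis uG : unimodularly_closed G.
Hypothesis nonnil : forall n, ~ lower_central (G := G) n `<=` [set 1].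
Hypothesis quotnil : forall K : set G, is_normal K -> ~ K `<=` [set 1] ->
  exists n, lower_central n `<=` K.
Implicit Types (x g : G) (K : set G).

(** Modulo a nontrivial center the group would be nilpotent, hence nilpotent itself. *)
Lemma jnn_center_trivial x : (forall g, [~ x, g] = 1) -> x = 1.
Proof.
move=> cx; apply: contrapT => x1.
have nZ := central_mod_normal (set1_normal G).
have [|n Zn] := quotnil nZ; first by move=> /(_ x cx).
apply: (nonnil (n := n.+1)); apply: comm_subgroup_min => [|y g /Zn Zy _].
  by case: (set1_normal G).
exact: Zy.
Qed.

(* In the nilpotent quotient [G / K] only [1] is mapped to [1]. *)
Lemma jnn_word_map_surj K e f : is_normal K -> ~ K `<=` [set 1] ->
  e = 1%R \/ e = (-1)%R -> word_map e f -> f 1 = 1 ->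
  forall y, K y -> exists2 x, K x & f x = y.
Proof.
move=> nK K1 e1 wf f1 y Ky; have [n Kn] := quotnil nK K1.
have [x fx] := unimodularly_closed_map e1 uG wf y.
exists x => //; pose N := NormalSubgroup nK.
have [h wh hf] := word_map_quot N wf.
apply/(quot_proj_eq1 N).
apply: (nilpotent_word_map_inj e1 (quot_nilpotent (N := N) Kn) wh).
rewrite hf fx -(quot_proj1 N) hf f1.
exact/quot_proj_eq1.
Qed.

Lemma jnn_no_finite K : is_normal K -> finite_set K -> K `<=` [set 1].
Proof.
move=> nK fK; apply: contrapT => K1.
pose C n := `[< exists B : set G,
  [/\ is_normal B, ~ B `<=` [set 1], finite_set B & #|` fset_set B| = n] >].
have exC : exists n, C n.
  by exists #|` fset_set K|; apply/asboolP; exists K.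
have [_ /asboolP [B [nB B1 fB <-]] minB] := ex_minnP exC.
have subB B' : is_normal B' -> ~ B' `<=` [set 1] -> B' `<=` B -> B' = B.
  move=> nB' B'1 B'B; have fB' : finite_set B' by exact: sub_finite_set fB.
  have cB : (#|` fset_set B| <= #|` fset_set B'|)%N.
    by apply: minB; apply/asboolP; exists B'.
  apply: fset_set_inj => //; apply/eqP; rewrite eqEfcard cB andbT.
  by rewrite -fset_set_sub.
have [b Bb b1] : exists2 b, B b & b <> 1.
  apply: contrapT => no; apply: B1 => b Bb; apply: contrapT => b1.
  by apply: no; exists b.
have bB : normal_closure b = B.
  apply: subB; first exact: normal_closure_normal.
    move=> nb1; have : [set (1 : G)] b by apply: nb1; exact: mem_normal_closure.
    by [].
  exact: normal_closure_min.
(* By minimality [B, G] is 1 or [B], and 1 would put [b] in the center. *)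
have BG : comm_subgroup B setT = B.
  apply: subB; first by apply: comm_subgroup_normal => //; exact: setT_normal.
    move=> B'1; apply: b1; apply: jnn_center_trivial => g.
    by apply: B'1; exact: mem_comm_subgroup.
  exact: comm_subgroup_sub.
have [f [wf f1 fb]] : exists f, [/\ word_map 0 f, f 1 = 1 & f b = b].
  by apply: normal_closure_comm_word; rewrite bB BG.
(* [h] sends both 1 and [b] to 1, so [B] without [b] still maps onto [B], against finiteness. *)
pose h x := x / f x.
have wh : word_map 1 h.
  have := word_mapM (word_map_id G) (word_mapV wf).
  by rewrite oppr0 addr0.
have hsurj := @jnn_word_map_surj B 1%R h nB B1 (or_introl erefl) wh.
have hB : B `<=` h @` (B `\ b).
  move=> y /hsurj [|x Bx hx]; first by rewrite /h f1 mulgV.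
  have [xb|xb] := pselect (x = b); last by exists x.
  exists 1; first by split; [exact: normal1|move/esym].
  by rewrite -hx xb /h f1 fb !mulgV.
have fBb : finite_set (B `\ b) by apply: sub_finite_set fB => ? [].
have : (#|` fset_set B| <= #|` fset_set (B `\ b)|)%N.
  apply: (@leq_trans #|` (h @` fset_set (B `\ b))%fset|); last exact: leq_imfset_card.
  apply: fsubset_leq_card; rewrite -fset_set_image // -fset_set_sub //.
  exact: finite_image.
have Bb' : b \in fset_set B by rewrite in_fset_set // mem_set.
by rewrite fset_setD1 // (cardfsD1 b (fset_set B)) Bb' ltnn.
Qed.

(** * Abelian normal closures *)

Section AbelianClosure.
Variables (b : G).
Hypothesis b1 : b <> 1.
Let N := NormalSubgroup (normal_closure_normal b).
Hypothesis abN : is_abelian (ns_set N).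
Local Notation V := (additive_of abN).
Local Notation cj := (@vconj _ _ abN).

Let N1 : ~ ns_set N `<=` [set 1].
Proof. by move=> N1; apply: b1; have : [set (1 : G)] b by apply: N1; exact: mem_normal_closure. Qed.

Let v0 : V := add_of abN (@mem_normal_closure _ b).

Let v0_neq0 : v0 <> 0%R.
Proof. by move/(congr1 val). Qed.

Definition acts_trivially (H : set G) := forall h v, H h -> cj h v = v.

Lemma sub_acts_trivially H : H `<=` ns_set N -> acts_trivially H.
Proof.
move=> HN h v /HN Nh; apply: val_inj; rewrite /= conjgE.
by rewrite (abN (add_ofP v) Nh) mulKg.
Qed.

(* The last term of the lower central series acting nontrivially provides [z]. *)
Lemma jnn_central_action : exists z,
  (exists v, cj z v <> v) /\
  forall g v, cj g (cj z v) = cj z (cj g v).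
Proof.
have [n Nn] := quotnil (ns_normal N) N1.
have : exists k, `[< acts_trivially (lower_central k) >].
  by exists n; apply/asboolP; exact: sub_acts_trivially.
move=> exk; have [[|k] /asboolP tk mink] := ex_minnP exk.
  (* If the whole group acts trivially, then [b] is central. *)
  case: v0_neq0; apply: val_inj; apply: jnn_center_trivial => g.
  by apply/eqP/conjg_fixP; have /(congr1 val) := tk g v0 I.
have [z [Lz nz]] : exists z, lower_central k z /\ exists v, cj z v <> v.
  apply: contrapT => no; have : (k.+1 <= k)%N; last by rewrite ltnn.
  apply: mink; apply/asboolP => z v Lz; apply: contrapT => nz.
  by apply: no; exists z; split=> //; exists v.
exists z; split=> // g v; rewrite -!vconjM commgC vconjM.
by rewrite tk //; exact: lower_central_comm.
Qed.

Variable z : G.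
Hypothesis z_neq1 : exists v, cj z v <> v.
Hypothesis zC : forall g v, cj g (cj z v) = cj z (cj g v).

Let J := {poly int}.
Local Notation VJ := (poly_module (cj z : {additive V -> V})).
Let act g : {linear VJ -> VJ} := poly_linear (zC g : forall u, cj g _ = _).
Let ann (a : J) : Prop := forall v : VJ, (a *: v)%R = 0%R.

Let actE g (v : VJ) : act g v = cj g v. Proof. by []. Qed.

Lemma val_act g (v : VJ) : val (act g v : V) = val (v : V) ^ g.
Proof. by []. Qed.

(** Horner's rule, with [X] read as conjugation by [z]. Conjugation preserves exponent sums, whence
    the evaluation at 1. *)
Lemma poly_word_map (a : J) :
  exists2 f, word_map a.[1]%R f & forall v : VJ, f (val (v : V)) = val ((a *: v)%R : V).
Proof.
elim/poly_ind: a => [|a c [f wf fE]].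
  exists (fun=> 1); first by rewrite horner0; exact: word_map_const.
  by move=> v; rewrite scale0r.
exists (fun x => f x ^ z * expgz x c).
  rewrite hornerMXaddC mulr1; apply: word_mapM; first exact: word_mapJ.
  exact: word_map_expgz.
move=> v; rewrite fE scalerDl.
rewrite -(valMz (v : V) c) -val_vconj -valD; congr val; congr (_ + _)%R.
  rewrite -[LHS](poly_scale_comm _ v (fun _ => erefl)).
  exact/esym/poly_scaleMX.
exact/esym/poly_scaleC.
Qed.

Lemma poly_surj (a : J) : a.[1]%R = 1%R -> forall v : VJ, exists u : VJ, (a *: u)%R = v.
Proof.
move=> a1 v; have [f wf fE] := poly_word_map a.
have f1 : f 1 = 1 by rewrite -(val0 abN) (fE 0%R) scaler0.
have [x Nx fx] := jnn_word_map_surj (ns_normal N) N1 (or_introl a1) wf f1 (add_ofP (v : V)).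
exists (add_of abN Nx); apply: (@val_inj _ _ V).
by rewrite -fE.
Qed.

(* The kernel of [a] is normal in [G], hence contains a term of the lower
   central series; as the center is trivial this forces [a] to kill [V]. *)
Lemma poly_inj (a : J) (v : VJ) : ~ ann a -> (a *: v)%R = 0%R -> v = 0%R.
Proof.
move=> na av; apply: contrapT => v_neq0.
pose K := [set x | exists2 u : VJ, val (u : V) = x & (a *: u)%R = 0%R].
have nK : is_normal K.
  split=> [|_ g [u <- au]]; last first.
    by exists (act g u); rewrite // -linearZ au linear0.
  split=> [|_ _ [u <- au] [w <- aw]|_ [u <- au]].
  - by exists 0%R; rewrite ?scaler0.
  - by exists (u + w)%R; rewrite // scalerDr au aw addr0.
  - by exists (- u)%R; rewrite // scalerN au oppr0.
have [|n Kn] := quotnil nK.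
  by move=> K1; apply: v_neq0; apply: (@val_inj _ _ V); apply: K1; exists v.
(* Each lower central term meets [V] in a vector not killed by [a]: as [a *: w] is not central, some
   [g] moves it, and the commutator of [w] with [g] is the next vector. *)
have [w [Lw aw]] : exists w : VJ, lower_central n (val (w : V)) /\ (a *: w)%R <> 0%R.
  elim: (n) => [|k [w [Lw aw]]].
    apply: contrapT => no; apply: na => w; apply: contrapT => aw.
    by apply: no; exists w.
  apply: contrapT => no; apply: aw; apply: (@val_inj _ _ V).
  apply: jnn_center_trivial => g; apply/eqP/conjg_fixP.
  rewrite -val_act; congr val; apply/eqP; rewrite -subr_eq0 linearZ -(scalerBr a (act g w) w).
  apply/eqP; apply: contrapT => agw; apply: no; exists (act g w - w)%R; split=> //.
  rewrite valB val_act; have -> : val (w : V) ^ g / val (w : V) = [~ val (w : V), g].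
    rewrite commgEl; apply: abN; first exact: (nsJ (N := N)) (add_ofP _).
    by apply: (@nsV _ N); exact: (add_ofP (w : V)).
  exact: lower_central_comm.
have [u uw au] := Kn _ Lw.
by apply: aw; rewrite -(_ : u = w) //; exact: val_inj.
Qed.

Lemma ann_prime : is_prime_ideal ann.
Proof.
split.
- by move=> v; rewrite scale0r.
- by move=> a c aP cP v; rewrite scalerDl aP cP addr0.
- by move=> a c cP v; rewrite -scalerA cP scaler0.
- by move=> P1; apply: v0_neq0; have := P1 v0; rewrite scale1r.
- move=> a c acP; have [aP|naP] := pselect (ann a); first by left.
  by right=> v; apply: (poly_inj naP); rewrite scalerA acP.
Qed.

Let phi : J := ('X - 1)%R.

Lemma phi_not_ann : ~ ann phi.
Proof.
move=> phiP; have [v] := z_neq1; apply.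
have <- : ('X *: (v : VJ))%R = cj z v.
  have := poly_scaleMX (cj z : {additive V -> V}) 1 v; rewrite mul1r poly_scale1.
  exact.
by have := phiP v; rewrite scalerBl scale1r => /eqP; rewrite subr_eq0 => /eqP.
Qed.

Lemma phi_divisible (M : set VJ) : M = setT -> divisible ann phi M.
Proof.
move=> -> g; have e1 : (1 + phi * g).[1]%R = 1%R.
  by rewrite hornerD hornerM hornerXsubC subrr mul0r hornerC addr0.
split=> [aP|v _]; last by have [u] := poly_surj e1 v; exists u.
by have [u uv] := poly_surj e1 v0; apply: v0_neq0; rewrite -uv aP.
Qed.


(* The invariant of the descent along a polycyclic series of [G]: it holds for
   cyclic [Z[X]]-modules by reduction to a finite residue field, propagates to
   [adjoin], and would fail for [M = V]. *)
Definition tame (O : set G) (M : set VJ) : Prop :=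
  [/\ stable act O M, acc act O M, scale_closed M, M v0
    & forall a, ~ ann a -> ~ divisible ann a M].

Lemma stable_scale O (M : set VJ) : stable act O M -> O z -> scale_closed M.
Proof.
move=> sM Oz a; elim/poly_ind: a => [|a c IHa] v Mv.
  by rewrite scale0r; exact: stable0 sM.
rewrite scalerDl; apply: (stableD sM).
  have -> : ((a * 'X) *: v = a *: act z v)%R by exact: poly_scaleMX.
  by apply: IHa; exact: stable_act sM Oz Mv.
have -> : (c%:P *: v = v *~ c)%R by exact: poly_scaleC.
exact: stableMz sM Mv.
Qed.

Lemma adjoin_cyclic (v : VJ) :
  adjoin act z [set (v *~ n)%R | n in setT] `<=` [set (a *: v)%R | a in setT].
Proof.
have XnE n (u : VJ) : iter n (act z) u = ('X^n *: u)%R.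
  elim: n u => [|n IHn] u; first by rewrite scale1r.
  by rewrite iterSr IHn exprSr; exact/esym/poly_scaleMX.
have CE n (u : VJ) : (u *~ n = n%:P *: u)%R by exact/esym/poly_scaleC.
move=> w [n]; elim: n w => [|n IHn] /= w.
  by move=> [k _ <-]; exists (k%:P)%R; rewrite // CE.
move=> [u [_ [/IHn [a _ <-] [k _ <-] ->]]]; exists (a + 'X^(n.+1) * k%:P)%R => //.
by rewrite scalerDl -scalerA -CE -XnE.
Qed.

Lemma ann_generator (a : J) : (a *: (v0 : VJ) = 0)%R -> ann a.
Proof. by move=> av; apply: contrapT => na; apply: v0_neq0; exact: poly_inj av. Qed.

(** A solution of (1 + a g) u = v0 in the cyclic module makes 1 + a g invertible modulo [ann], which
    fails as soon as 1 + a g vanishes in a residue field. *)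
Lemma cyclic_not_divisible (M : set VJ) (a : J) : M v0 ->
  M `<=` [set (c *: (v0 : VJ))%R | c in setT] -> ~ ann a -> ~ divisible ann a M.
Proof.
move=> Mv0 McV na dM.
have [K [p [f [[chK _] fP fa [e e_gt0 fe]]]]] :=
  finite_residues_poly finite_residues_int ann_prime na.
have q_gt1 : (1 < p ^ e)%N.
  by rewrite -(exp1n e) ltn_exp2r // prime_gt1 // (pcharf_prime chK).
(* With q = p^e, the image of [a] has inverse a^(q-2) in the residue field; [q_gt1] keeps the
   subtraction exact. *)
pose g := (- a ^+ (p ^ e - 2))%R.
have fag : (f (1 + a * g) = 0)%R.
  have {}fe := fe a; move: q_gt1 fe; rewrite /g.
  case: (p ^ e)%N => [|[|q]] //= _; rewrite subSS subSS subn0 => fe.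
  apply: (mulfI fa); rewrite mulr0 rmorphD rmorphM rmorphN rmorphXn rmorph1.
  by rewrite mulrDr mulr1 !mulrN mulrA -expr2 -exprD fe subrr.
have [_ /(_ _ Mv0) [u /McV [c _ <-]]] := dM g.
rewrite scalerA => e1; have : ann (1 - (1 + a * g) * c)%R.
  by apply: ann_generator; rewrite scalerBl scale1r e1 subrr.
move=> /fP; rewrite rmorphB rmorphM fag mul0r subr0 rmorph1 => /eqP.
by rewrite oner_eq0.
Qed.

(** The cyclic module arises by adjoining [z] to the integer multiples of [v0]. *)
Lemma tame_cyclic : exists M, tame [set z] M.
Proof.
pose M0 := [set ((v0 : VJ) *~ n)%R | n in setT].
have sM0 : stable act set0 M0.
  split=> //; first by exists 0%R; rewrite // mulr0z.
  by move=> _ _ [m _ <-] [n _ <-]; exists (m - n)%R; rewrite // mulrzBr.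
have nz : normalizes act set0 z by split.
have Mv0 : adjoin act z M0 v0 by apply: sub_adjoin; exists 1%R.
exists (adjoin act z M0); have := stable_adjoin nz sM0; rewrite set0U => sM.
split=> //.
- by have := acc_adjoin nz sM0 (@acc_cyclic _ _ _ act set0 _); rewrite set0U.
- exact: stable_scale sM _.
- by move=> a; apply: cyclic_not_divisible => //; exact: adjoin_cyclic.
Qed.

Lemma tame_adjoin O y M : normalizes act O y -> tame O M ->
  tame (O `|` [set y]) (adjoin act y M).
Proof.
move=> nOy [sM aM JM Mv0 dM]; split.
- exact: stable_adjoin.
- exact: acc_adjoin.
- exact: adjoin_scale.
- exact: sub_adjoin.
move=> a na da.
have [c nc] := divisible_adjoin (prime_ideal1 ann_prime) (@prime_idealM _ _ ann_prime)
  nOy sM aM JM da.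
by apply: dM => /(prime_idealM ann_prime) [].
Qed.

Lemma tame_stable O O' M : (forall L, stable act O L <-> stable act O' L) ->
  tame O M -> tame O' M.
Proof.
move=> OO' [sM aM JM Mv0 dM]; split=> //; first exact/OO'.
by move=> L sL; apply: aM => k; exact/OO'.
Qed.

(** As [z] may lie outside [H], it is added with its inverse; the descent can then start from a
    cyclic module where [H] acts trivially. *)
Definition tame_subgroup (H : set G) := exists M, tame (H `|` [set z] `|` [set z^-1]) M.

Let actM g h (v : VJ) : act (g * h) v = act h (act g v).
Proof. exact: vconjM. Qed.

Let act1 (v : VJ) : act 1 v = v.
Proof. exact: vconj1. Qed.

Lemma act_zV g v : act g (act z^-1 v) = act z^-1 (act g v).
Proof.
have {2}-> : v = act z (act z^-1 v) by rewrite -actM mulVg act1.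
have -> : act g (act z (act z^-1 v)) = act z (act g (act z^-1 v)) by exact: zC.
by rewrite -(actM z) mulgV act1.
Qed.

Lemma tame_trivial H : acts_trivially H -> tame_subgroup H.
Proof.
move=> tH; have [M tM] := tame_cyclic.
exists (adjoin act z^-1 M); apply: tame_stable (tame_adjoin _ tM).
  move=> L; split=> -[L0 LB LA]; split=> // g v Og Lv.
    case: Og => [[Hg|->]|->]; last 2 first.
    - by apply: LA => //; left.
    - by apply: LA => //; right.
    by rewrite actE tH.
  by apply: LA => //; case: Og => [->|->]; [left; right|right].
split=> _ ->; exists z => // v; first by rewrite act_zV.
by rewrite act_zV.
Qed.

(** A cyclic extension of [H]: first [x], then [x^-1] is adjoined, each normalizing the operators
    already present. *)
Lemma tame_gen H x : is_subgroup H -> (forall h, H h -> H (h ^ x)) ->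
  (forall h, H h -> H (h ^ x^-1)) -> tame_subgroup H ->
  tame_subgroup (gen_subgroup (H `|` [set x])).
Proof.
move=> sH Hx Hx' [M tM].
have nzx y : (forall h, H h -> H (h ^ y)) -> (forall h, H h -> H (h ^ y^-1)) ->
    normalizes act (H `|` [set z] `|` [set z^-1]) y.
  move=> Hy Hy'; split=> g [[Hg|->]|->].
  - exists (g ^ y^-1); first by left; left; exact: Hy'.
    by move=> v; rewrite -!actM conjgCV.
  - by exists z; [left; right|move=> v; rewrite !actE zC].
  - by exists z^-1; [right|move=> v; rewrite act_zV].
  - exists (g ^ y); first by left; left; exact: Hy.
    by move=> v; rewrite -!actM conjgC.
  - by exists z; [left; right|move=> v; rewrite !actE zC].
  - by exists z^-1; [right|move=> v; rewrite act_zV].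
have nx := nzx x Hx Hx'.
have nx' : normalizes act (H `|` [set z] `|` [set z^-1] `|` [set x]) x^-1.
  have [|nl nr] := nzx x^-1 Hx'; first by rewrite invgK.
  split=> g [Og|->].
  - by have [g' Og' gE] := nl g Og; exists g' => //; left.
  - by exists x; [right|move=> v; rewrite -!actM mulgV mulVg].
  - by have [g' Og' gE] := nr g Og; exists g' => //; left.
  - by exists x; [right|move=> v; rewrite -!actM mulgV mulVg].
exists (adjoin act x^-1 (adjoin act x M)).
apply: tame_stable (tame_adjoin nx' (tame_adjoin nx tM)) => L.
have gx : gen_subgroup (H `|` [set x]) x by apply: sub_gen_subgroup; right.
split=> -[L0 LB LA]; split=> //; last first.
  move=> g v Og Lv; apply: LA => //; case: Og => [[[[Hg|->]|->]|->]|->].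
  - by left; left; apply: sub_gen_subgroup; left.
  - by left; right.
  - by right.
  - by left; left.
  - by left; left; case: (gen_subgroupP (H `|` [set x])) => _ _; apply.
have Lgen g : gen_subgroup (H `|` [set x]) g ->
    (forall v, L v -> L (act g v)) /\ (forall v, L v -> L (act g^-1 v)).
  move=> /(_ [set g | (forall v, L v -> L (act g v)) /\
                      (forall v, L v -> L (act g^-1 v))]); apply.
    split=> [|g1 g2 [L1 L1'] [L2 L2']|g1 [L1 L1']].
    - by split=> v Lv; rewrite ?invg1 act1.
    - by split=> v Lv; rewrite ?invgM actM; [apply: L2; exact: L1|apply: L1'; exact: L2'].
    - by split=> //; rewrite invgK.
  move=> g' [Hg|->]; split=> v Lv; apply: LA => //.
  - by left; left; left; left.
  - by left; left; left; left; case: sH => _ _; apply.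
  - by left; right.
  - by right.
move=> g v [[Og|->]|->] Lv; first by case: (Lgen g Og) => Lg _; exact: Lg.
  by apply: LA => //; left; left; left; right.
by apply: LA => //; left; left; right.
Qed.

(** The factor of two consecutive terms is generated by finitely many left-normed commutators,
    adjoined one at a time. Each intermediate subgroup is normal because the factor is central. *)
Lemma tame_lower_central n :
  tame_subgroup (lower_central n.+1) -> tame_subgroup (lower_central n).
Proof.
move=> tL; pose H (l : seq G) := gen_subgroup (lower_central n.+1 `|` [set` l]).
have H_sub l : [set` l] `<=` lower_central n -> H l `<=` lower_central n.
  move=> ln x; apply; first by case: (lower_central_normal G n).
  by move=> y [/lower_centralS|/ln].
have HJ l g x : [set` l] `<=` lower_central n -> H l x -> H l (x ^ g).
  move=> ln Hx; have -> : x ^ g = x * [~ x, g] by rewrite commgEl mulVKg.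
  case: (gen_subgroupP (lower_central n.+1 `|` [set` l])) => _ HM _; apply: HM => //.
  apply: sub_gen_subgroup; left; apply: lower_central_comm.
  exact: H_sub Hx.
have tH l : [set` l] `<=` lower_central n -> tame_subgroup (H l).
  elim: l => [|x l IHl] ln.
    suff -> : H [::] = lower_central n.+1 by [].
    apply/seteqP; split=> [x|x Lx]; last by apply: sub_gen_subgroup; left.
    by apply; [case: (lower_central_normal G n.+1)|move=> y []].
  have ln' : [set` l] `<=` lower_central n.
    by move=> y yl; apply: ln; rewrite /= inE yl orbT.
  have -> : H (x :: l) = gen_subgroup (H l `|` [set x]).
    apply/seteqP; split=> y; apply; try exact: gen_subgroupP.
      move=> w [Lw|/=]; first by apply: sub_gen_subgroup; left; apply: sub_gen_subgroup; left.
      rewrite inE => /orP [/eqP ->|wl]; apply: sub_gen_subgroup; first by right.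
      by left; apply: sub_gen_subgroup; right.
    move=> w [|->]; last by apply: sub_gen_subgroup; right; rewrite /= inE eqxx.
    apply; first exact: gen_subgroupP.
    by move=> t [Lt|tl]; apply: sub_gen_subgroup; [left|right; rewrite /= inE tl orbT].
  apply: tame_gen (IHl ln'); first exact: gen_subgroupP.
    by move=> h; exact: HJ.
  by move=> h; exact: HJ.
have lL := @left_normed_lower_central G s n.
suff <- : H (left_normed s n) = lower_central n by exact: tH.
apply/seteqP; split; first exact: H_sub.
apply: (lower_central_normal_closure gens) => [|x xl].
  split; first exact: gen_subgroupP.
  by move=> x g; exact: HJ.
by apply: sub_gen_subgroup; right.
Qed.

(** At the top of the series, [M] contains [v0] and is stable under [G], so it is all of [V], where
    [phi] is divisible. *)
Lemma jnn_abelian_closure_false : False.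
Proof.
have [n Nn] := quotnil (ns_normal N) N1.
have : tame_subgroup (lower_central 0).
  have : tame_subgroup (lower_central n) by apply: tame_trivial; exact: sub_acts_trivially.
  by elim: n {Nn} => // n IHn /tame_lower_central.
move=> [M [[M0 MB MA] _ _ Mv0 /(_ phi phi_not_ann)]]; apply; apply: phi_divisible.
have sM : stable act (lower_central 0 `|` [set z] `|` [set z^-1]) M by [].
apply/seteqP; split=> // v _.
have /(_ [set x | exists2 u : VJ, val (u : V) = x & M u]) := add_ofP (v : V).
case=> [|_ [g _ <-]|u uv Mu]; last by rewrite -(_ : u = v) //; exact: val_inj.
  split=> [|_ _ [u <- Mu] [w <- Mw]|_ [u <- Mu]].
  - by exists 0%R.
  - by exists (u + w)%R => //; exact: stableD sM _ _.
  - by exists (- u)%R => //; exact: stableN sM _.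
by exists (act g v0) => //; apply: MA => //; left; left.
Qed.

End AbelianClosure.
End JustNonNilpotent.

Lemma jnn_false (G : groupType) (s : seq G) (K : set G) :
  gen_subgroup [set` s] = setT -> unimodularly_closed G ->
  (forall n, ~ lower_central (G := G) n `<=` [set 1]) ->
  (forall K : set G, is_normal K -> ~ K `<=` [set 1] ->
    exists n, lower_central n `<=` K) ->
  is_normal K -> ~ K `<=` [set 1] -> finite_set K \/ is_abelian K -> False.
Proof.
move=> gens uG nonnil quotnil nK K1 [fK|abK].
  exact: K1 (jnn_no_finite uG nonnil quotnil nK fK).
have [b Kb b1] : exists2 b, K b & b <> 1.
  apply: contrapT => no; apply: K1 => b Kb; apply: contrapT => b1.
  by apply: no; exists b.
have bK := normal_closure_min nK Kb.
have abN : is_abelian (ns_set (NormalSubgroup (normal_closure_normal b))).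
  by move=> x y /bK Kx /bK Ky; exact: abK.
have [z [z1 zC]] := jnn_central_action nonnil quotnil b1 abN.
exact (jnn_abelian_closure_false gens uG nonnil quotnil b1 z1 zC).
Qed.

(* Zorn's lemma applies since each [lower_central n] is the normal closure of a
   finite set. *)
Lemma maximal_non_nilpotent (G : groupType) (s : seq G) :
  gen_subgroup [set` s] = setT -> ~ nilpotent_group G ->
  exists2 N : set G, is_normal N /\ (forall n, ~ lower_central n `<=` N) &
  forall K : set G, is_normal K -> N `<` K -> exists n, lower_central n `<=` K.
Proof.
move=> gens nG.
pose P (N : set G) := N = set0 \/ (is_normal N /\ forall n, ~ lower_central n `<=` N).
have P1 : P [set 1].
  right; split=> [|n Ln]; first exact: set1_normal.
  by apply: nG; apply/nilpotentE; exists n.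
have [F FP totF|N [PN maxN]] := @Zorn_bigcup G P.
  have [[X [FX [x0 Xx0]]]|no] := pselect (exists X, F X /\ X !=set0); last first.
    left; apply/seteqP; split=> // x [X FX Xx].
    by case: no; exists X; split=> //; exists x.
  have FN Y y : F Y -> Y y -> is_normal Y /\ forall n, ~ lower_central n `<=` Y.
    by move=> /FP [->|].
  have nX := (FN X x0 FX Xx0).1.
  have common (l : seq G) : [set` l] `<=` \bigcup_(Y in F) Y ->
      exists Y, [/\ F Y, is_normal Y & [set` l] `<=` Y].
    elim: l => [|x l IHl] lF; first by exists X.
    have [|Y [FY nY lY]] := IHl.
      by move=> y yl; apply: lF; rewrite /= inE yl orbT.
    have [|Z FZ Zx] := lF x; first by rewrite /= inE eqxx.
    have [YZ|ZY] := totF Y Z FY FZ.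
      exists Z; split=> //; first by case: (FN Z x).
      by move=> y; rewrite /= inE => /orP [/eqP ->//|/lY /YZ].
    exists Y; split=> // y; rewrite /= inE => /orP [/eqP ->|/lY //].
    exact: ZY.
  right; split=> [|n Ln].
    split=> [|x g [Y FY Yx]]; last first.
      by exists Y => //; exact: (normalJ g (FN Y x FY Yx).1 Yx).
    split=> [|x y [Y FY Yx] [Z FZ Zy]|x [Y FY Yx]].
    - by exists X => //; exact: normal1.
    - have [YZ|ZY] := totF Y Z FY FZ.
        by exists Z => //; exact: (normalM (FN Z y FZ Zy).1 (YZ x Yx) Zy).
      by exists Y => //; exact: (normalM (FN Y x FY Yx).1 Yx (ZY y Zy)).
    - by exists Y => //; exact: (normalV (FN Y x FY Yx).1 Yx).
  (* A lower central term inside the union has finitely many normal generators, so it already lies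
     in one member. *)
  have [|Y [FY nY lY]] := common (left_normed s n).
    by apply: subset_trans Ln; exact: left_normed_lower_central.
  case: (FN Y 1 FY (normal1 nY)) => _ /(_ n); apply.
  exact: (lower_central_normal_closure gens nY lY).
have {PN} [N0|PN] := PN.
  by case: (maxN [set 1]) => //; rewrite N0; split=> // /(_ 1); apply.
exists N => // K nK NK; apply: contrapT => no; apply: (maxN K) => //.
by right; split=> // n Ln; apply: no; exists n.
Qed.

Theorem nilpotent_of_quotients (G : groupType) :
  finitely_generated G -> quotients_have_finite_or_abelian_normal G ->
  unimodularly_closed G -> nilpotent_group G.
Proof.
move=> [s gens] qG uG; apply: contrapT => nG.
have [A [nA nL] maxA] := maximal_non_nilpotent gens nG.
pose N := NormalSubgroup nA.
have [t gent] : finitely_generated (quot_group N).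
  by apply: quot_finitely_generated; exists s.
have nonnil n : ~ lower_central (G := quot_group N) n `<=` [set 1].
  rewrite quot_lower_central => Ln; apply: (nL n) => x Lx.
  by apply/(quot_proj_eq1 N); apply: Ln; exists x.
have ntN : [set: quot_group N] <> [set 1].
  by move=> T1; apply: (nonnil 0%N); rewrite /= T1.
have [K [nK K1 fabK]] := qG N ntN.
apply: (jnn_false gent (quot_unimodularly_closed uG) nonnil _ nK _ fabK); last first.
  by move=> sK; apply: K1; exact: normal_sub1.
move=> L nL' L1; have [|n Ln] := maxA _ (preimage_normal nL').
  split=> [x Ax /=|sub].
    by rewrite (_ : quot_proj N x = 1); [exact: normal1|exact/quot_proj_eq1].
  apply: L1 => a La; rewrite -(quot_projK a); apply/quot_proj_eq1.
  by apply: sub; rewrite /= quot_projK.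
by exists n; rewrite quot_lower_central => _ [x /Ln Lx <-].
Qed.

(** * Nilpotent linear groups *)

Local Open Scope ring_scope.

Section RelativeSeries.
Variable G : groupType.
Implicit Types (H : set G).

(** The series of a subgroup are formed inside [G], so that [H] need not become a group type of its
    own. *)
Fixpoint derived_of H n : set G :=
  if n is n'.+1 then comm_subgroup (derived_of H n') (derived_of H n') else H.

Fixpoint lower_central_of H n : set G :=
  if n is n'.+1 then comm_subgroup (lower_central_of H n') H else H.

Lemma derived_ofT n : derived_of setT n = derived_series (G := G) n.
Proof. by elim: n => //= n ->. Qed.

Lemma lower_central_ofT n : lower_central_of setT n = lower_central (G := G) n.
Proof. by elim: n => //= n ->. Qed.

Lemma derived_of_subgroup H n : is_subgroup H -> is_subgroup (derived_of H n).
Proof. by case: n => [|n] // _; exact: gen_subgroupP. Qed.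

Lemma subgroupR H x y : is_subgroup H -> H x -> H y -> H [~ x, y]%g.
Proof.
move=> [_ HM HV] Hx Hy; rewrite /commg /conjg.
exact: (HM _ _ (HV _ Hx) (HM _ _ (HV _ Hy) (HM _ _ Hx Hy))).
Qed.

Lemma derived_ofS H n : is_subgroup H -> derived_of H n.+1 `<=` derived_of H n.
Proof.
move=> sH; have sD := derived_of_subgroup n sH.
by apply: comm_subgroup_min => // x y; exact: subgroupR.
Qed.

Lemma derived_of_sub H n : is_subgroup H -> derived_of H n `<=` H.
Proof.
by move=> sH; elim: n => // n IHn; apply: subset_trans IHn; exact: derived_ofS.
Qed.

Lemma derived_of_comm H n : derived_of (comm_subgroup H H) n = derived_of H n.+1.
Proof. by elim: n => //= n ->. Qed.

Lemma lower_central_of_comm H n : is_subgroup H ->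
  lower_central_of (comm_subgroup H H) n `<=` lower_central_of H n.
Proof.
move=> sH; have sub := @derived_ofS H 0 sH.
by elim: n => //= n IHn; exact: comm_subgroupS.
Qed.

End RelativeSeries.

Section NilpotentLinear.
Variables (G : groupType) (K : closedFieldType) (m : nat) (rho : G -> 'M[K]_m).
Hypothesis rho1 : rho 1%g = 1%:M.
Hypothesis rhoM : forall x y, rho (x * y)%g = rho x *m rho y.
Implicit Types (H : set G) (U : 'M[K]_m) (x y h : G).

Let rhoV x : rho x *m rho x^-1%g = 1%:M.
Proof. by rewrite -rhoM mulgV. Qed.

Let rhoVl x : rho x^-1%g *m rho x = 1%:M.
Proof. by rewrite -rhoM mulVg. Qed.

(** [U] stands for its row space, on which [x] acts as the identity. *)
Definition fixes U x := U *m rho x = U.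

Lemma fixes_subgroup U : is_subgroup [set x | fixes U x].
Proof.
split=> [|x y Ux Uy|x Ux]; rewrite /= /fixes.
- by rewrite rho1 mulmx1.
- by rewrite rhoM mulmxA Ux Uy.
- by rewrite -{1}Ux -mulmxA rhoV mulmx1.
Qed.

Lemma fixes_sub U U' x : (U' <= U)%MS -> fixes U x -> fixes U' x.
Proof. by move=> /submxP [Y ->] Ux; rewrite /fixes -mulmxA Ux. Qed.

Section StableSubspace.
Variables (H : set G) (U : 'M[K]_m).
Hypothesis sH : is_subgroup H.
Hypothesis HU : forall h, H h -> (U *m rho h <= U)%MS.

Lemma sub_stable_mul h : H h -> (U <= U *m rho h)%MS.
Proof.
move=> Hh; have := HU (h := h^-1%g); case: sH => _ _ HV /(_ (HV _ Hh)).
by move=> /(submxMr (rho h)); rewrite -mulmxA rhoVl mulmx1.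
Qed.

Lemma stable_mul0 h (X : 'M[K]_m) : H h -> U *m X = 0 -> U *m rho h *m X = 0.
Proof. by move=> Hh UX; have /submxP [Y ->] := HU Hh; rewrite -mulmxA UX mulmx0. Qed.

Lemma mul0_stable h (X : 'M[K]_m) : H h -> U *m rho h *m X = 0 -> U *m X = 0.
Proof.
by move=> Hh UX; have /submxP [Y UE] := sub_stable_mul Hh; rewrite UE -mulmxA UX mulmx0.
Qed.

Lemma fixes_commutator x y : H x -> H y ->
  U *m (rho x *m rho y) = U *m (rho y *m rho x) -> fixes U [~ x, y]%g.
Proof.
move=> Hx Hy UC; have Hyx : H (y * x)%g by case: sH => _ HM _; exact: HM.
apply/eqP; rewrite /fixes -subr_eq0 -[X in _ - X]mulmx1 -mulmxBr; apply/eqP.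
apply: (mul0_stable Hyx).
by rewrite -mulmxA mulmxBr mulmx1 -rhoM -commgC (rhoM x) (rhoM y) mulmxBr UC subrr.
Qed.

Definition scalar_on x := exists c : K, U *m rho x = c *: U.

Lemma fixes_scalar_on x : fixes U x -> scalar_on x.
Proof. by move=> Ux; exists 1; rewrite scale1r. Qed.

Lemma scalar_commute x y : H x -> H y -> scalar_on x -> scalar_on y ->
  fixes U [~ x, y]%g.
Proof.
move=> Hx Hy [c Ux] [d Uy]; apply: fixes_commutator => //.
by rewrite !mulmxA Ux Uy -!scalemxAl Ux Uy !scalerA mulrC.
Qed.

(* The last term of the lower central series not acting by scalars provides [z]. *)
Lemma nonscalar_central n : (forall h, lower_central_of H n h -> fixes U h) ->
  (forall h, H h -> scalar_on h) \/
  exists2 z, H z & ~ scalar_on z /\ forall h, H h -> scalar_on [~ z, h]%g.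
Proof.
move=> Hn; have [|no] := pselect (exists2 z, H z &
  ~ scalar_on z /\ forall h, H h -> scalar_on [~ z, h]%g); first by right.
left; have subH k : lower_central_of H k `<=` H.
  elim: k => // k IHk; apply: comm_subgroup_min => // x y /IHk; exact: subgroupR.
suff down k : forall h, lower_central_of H (n - k) h -> scalar_on h.
  by have := down n; rewrite subnn.
elim: k => [|k IHk] h; first by rewrite subn0 => /Hn /fixes_scalar_on.
have [nk|kn] := leqP n k.
  by move: (IHk h); rewrite (eqP nk) (_ : n - k.+1 = 0)%N //; apply/eqP; rewrite subn_eq0 leqW.
move=> Lh; apply: contrapT => nh; apply: no; exists h; first exact: subH Lh.
split=> // g Hg; apply: IHk; rewrite -(subnSK kn) /=.
exact: mem_comm_subgroup.
Qed.

Lemma central_mod_scalars_commute z : U != 0 -> H z ->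
  (forall h, H h -> scalar_on [~ z, h]%g) ->
  forall h, comm_subgroup H H h -> U *m (rho z *m rho h) = U *m (rho h *m rho z).
Proof.
move=> U0 Hz zH.
have twist h : H h -> exists2 c : K, c != 0 &
    forall u : 'M_m, (u <= U)%MS -> u *m (rho z *m rho h) = c *: (u *m (rho h *m rho z)).
  move=> Hh; have [c Uc] := zH h Hh; exists c.
    apply: contraNneq U0 => c0; rewrite -[U]mulmx1 -(rhoV [~ z, h]%g) mulmxA Uc.
    by rewrite c0 scale0r mul0mx.
  move=> u /submxP [Y ->]; rewrite -rhoM commgC (rhoM (h * z)%g) (rhoM h).
  have Hhz : H (h * z)%g by case: sH => _ HM _; exact: HM.
  have /submxP [W WE] := HU Hhz; rewrite rhoM in WE.
  rewrite -!mulmxA; have -> : U *m (rho h *m (rho z *m rho [~ z, h]%g)) = c *: (U *m (rho h *m rho z)).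
    by rewrite (mulmxA (rho h)) mulmxA WE -mulmxA Uc scalemxAr.
  by rewrite -scalemxAr.
pose C := [set h | H h /\ U *m (rho z *m rho h) = U *m (rho h *m rho z)].
suff sub : comm_subgroup H H `<=` C by move=> h /sub [].
have zhC h : U *m (rho z *m rho h - rho h *m rho z) = 0 ->
    U *m (rho z *m rho h) = U *m (rho h *m rho z).
  by move=> /eqP; rewrite mulmxBr subr_eq0 => /eqP.
have Czh h : U *m (rho z *m rho h) = U *m (rho h *m rho z) ->
    U *m (rho z *m rho h - rho h *m rho z) = 0.
  by move=> e; rewrite mulmxBr e subrr.
apply: comm_subgroup_min.
  case: (sH) => H1 HM HV; split=> [|x y [Hx Ux] [Hy Uy]|x [Hx Ux]].
  - by split=> //; rewrite rho1 mulmx1 mul1mx.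
  - split; first exact: HM.
    rewrite rhoM !mulmxA -(mulmxA U (rho z)) Ux.
    have := stable_mul0 Hx (Czh _ Uy).
    rewrite mulmxBr => /eqP; rewrite subr_eq0 => /eqP e.
    by rewrite -!mulmxA in e *; rewrite e.
  - split; first exact: HV.
    apply: zhC; apply: (mul0_stable Hx); rewrite mulmxBr.
    rewrite !mulmxA -(mulmxA U (rho x) (rho x^-1%g)) rhoV mulmx1.
    have -> : U *m rho x *m rho z = U *m rho z *m rho x by rewrite -!mulmxA Ux.
    by rewrite -(mulmxA (U *m rho z)) rhoV mulmx1 subrr.
move=> x y Hx Hy; split; first exact: subgroupR.
have [c c0 cE] := twist x Hx; have [d d0 dE] := twist y Hy.
have Hyx : H (y * x)%g by case: sH => _ HM _; exact: HM.
have sub_U h : H h -> (U *m rho h <= U)%MS by exact: HU.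
apply: zhC; apply: (mul0_stable Hyx).
set u := [~ x, y]%g.
have zxy : U *m (rho z *m rho (x * y)%g) = (c * d) *: (U *m (rho (x * y)%g *m rho z)).
  rewrite rhoM (mulmxA (rho z)) (mulmxA U) (cE U) // -scalemxAl.
  by rewrite (mulmxA U (rho x)) -(mulmxA _ (rho z)) (dE _ (sub_U x Hx)) scalerA !mulmxA.
have zyx : U *m (rho z *m rho (y * x)%g) = (c * d) *: (U *m (rho (y * x)%g *m rho z)).
  rewrite rhoM (mulmxA (rho z)) (mulmxA U) (dE U) // -scalemxAl.
  rewrite (mulmxA U (rho y)) -(mulmxA _ (rho z)) (cE _ (sub_U y Hy)) scalerA mulrC.
  by rewrite !mulmxA.
have cd0 : c * d != 0 by rewrite mulf_neq0.
apply: (scalerI cd0); rewrite scaler0 mulmxBr scalerBr.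
have -> : (c * d) *: (U *m rho (y * x)%g *m (rho z *m rho u)) = U *m (rho z *m rho (x * y)%g).
  rewrite [(x * y)%g]commgC -/u (rhoM (y * x)%g) !mulmxA -(mulmxA U (rho z)) zyx.
  by rewrite -scalemxAl !mulmxA.
by rewrite zxy [(x * y)%g]commgC -/u (rhoM (y * x)%g) !mulmxA subrr.
Qed.

End StableSubspace.

Lemma stable_eigenvector U (A : 'M[K]_m) : U != 0 -> (U *m A <= U)%MS ->
  exists l : K, (U :&: kermx (A - l%:M))%MS != 0.
Proof.
move=> U0 UA; pose B := row_base U.
have BU : (B :=: U)%MS by exact: eq_row_base.
have rU : (0 < \rank U)%N by rewrite lt0n mxrank_eq0.
have BA : (B *m A <= B)%MS by rewrite BU (eqmxMr A BU).
have /submxP [Z ZE] := BA.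
have /closed_rootP [l] : size (char_poly Z) != 1%N.
  by rewrite size_char_poly eqSS -lt0n.
rewrite -eigenvalue_root_char => /eigenvalueP [v vZ v0]; exists l.
have wv0 : v *m B != 0.
  apply: contra v0 => /eqP vB; have := mulmxKp (row_base_free U) v.
  by rewrite /= -/B vB mul0mx => <-.
apply: contra wv0 => /eqP UK0; rewrite -submx0 -UK0 sub_capmx; apply/andP; split.
  by rewrite -BU submxMl.
by apply/sub_kermxP; rewrite mulmxBr -mulmxA ZE mulmxA vZ mul_mx_scalar -scalemxAl subrr.
Qed.

(* On [U], the commutator subgroup of [H] commutes with some nonscalar [z], so it
   preserves an eigenspace of [z] and the image of [z - l]. *)
Lemma nilpotent_linear_derived k H U n : is_subgroup H ->
  (forall h, H h -> (U *m rho h <= U)%MS) ->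
  (forall h, lower_central_of H n h -> fixes U h) ->
  (\rank U <= k)%N -> forall h, derived_of H k.*2 h -> fixes U h.
Proof.
elim: k H U => [|k IHk] H U sH HU nU rU.
  move=> h _; have /eqP -> : U == 0 by rewrite -mxrank_eq0 -leqn0.
  by rewrite /fixes mul0mx.
have [->|U0] := eqVneq U 0; first by move=> h _; rewrite /fixes mul0mx.
have [scal|[z Hz [nz zH]]] := nonscalar_central sH nU.
  suff sub : derived_of H 1 `<=` [set h | fixes U h].
    move=> h; rewrite doubleS => Dh; apply: sub.
    elim: (k.*2) Dh => [|j IHj]; first exact: (derived_ofS (n := 1) sH).
    by move=> /(derived_ofS sH); exact: IHj.
  apply: comm_subgroup_min; first exact: fixes_subgroup.
  by move=> x y Hx Hy; exact: (scalar_commute sH HU Hx Hy (scal x Hx) (scal y Hy)).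
have zC := central_mod_scalars_commute sH HU U0 Hz zH.
have [l Ul] := stable_eigenvector U0 (HU z Hz).
set T := rho z - l%:M in Ul.
pose H' := comm_subgroup H H.
have sH' : is_subgroup H' by exact: gen_subgroupP.
have H'H : H' `<=` H by exact: (@derived_ofS _ H 0).
have TC h : H' h -> U *m (T *m rho h) = U *m (rho h *m T).
  move=> Hh; rewrite mulmxBl mulmxBr !mulmxBr zC //.
  by rewrite mul_scalar_mx mul_mx_scalar.
have UT : (U *m T <= U)%MS.
  rewrite mulmxBr addmx_sub ?HU // eqmx_opp mul_mx_scalar.
  exact: scalemx_sub.
(* Kernel and image of [T] on [U] are both nonzero, so by rank-nullity both have rank below that of
   [U]. *)
have rk := mxrank_mul_ker U T.
have UT0 : U *m T != 0.
  apply/eqP => UT0; apply: nz; exists l; apply/eqP.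
  by rewrite -subr_eq0 -mul_mx_scalar -mulmxBr UT0.
have r1 : (0 < \rank (U :&: kermx T))%N by rewrite lt0n mxrank_eq0.
have r2 : (0 < \rank (U *m T))%N by rewrite lt0n mxrank_eq0.
have sU1 : (U :&: kermx T <= U)%MS by exact: capmxSl.
have nH' h : lower_central_of H' n h -> fixes U h.
  by move=> /(lower_central_of_comm sH); exact: nU.
have fix1 h : derived_of H' k.*2 h -> fixes (U :&: kermx T)%MS h.
  apply: IHk => // [g Hg|g /nH'|]; last 2 first.
  - exact: fixes_sub.
  - by rewrite -ltnS; apply: leq_trans rU; rewrite -rk -[X in (X < _)%N]add0n ltn_add2r.
  rewrite sub_capmx; apply/andP; split.
    by apply: submx_trans (submxMr _ sU1) _; apply: HU; exact: H'H.
  have /submxP [Y YE] := sU1; apply/sub_kermxP.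
  rewrite YE -!mulmxA -TC // !mulmxA -YE.
  have /sub_kermxP -> : (U :&: kermx T <= kermx T)%MS by exact: capmxSr.
  by rewrite mul0mx.
have fix2 h : derived_of H' k.*2 h -> fixes (U *m T) h.
  apply: IHk => // [g Hg|g /nH'|]; last 2 first.
  - exact: fixes_sub.
  - by rewrite -ltnS; apply: leq_trans rU; rewrite -rk -[X in (X < _)%N]addn0 ltn_add2l.
  by rewrite -mulmxA TC // mulmxA submxMr // HU //; exact: H'H.
(* Two derived steps per dimension: one went into [H'], the other is the commutator taken here. *)
rewrite doubleS -derived_of_comm -/H'.
apply: comm_subgroup_min; first exact: fixes_subgroup.
(* [h] is trivial on the image of [T], that is on [U] modulo the kernel, so h - 1 maps [U] into the
   kernel. Elements of the kernel are fixed too, whence (g - 1)(h - 1) = 0 on [U] and [g], [h]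
   commute there. *)
have diff h : derived_of H' k.*2 h -> (U *m (rho h - 1%:M) <= U :&: kermx T)%MS.
  move=> Dh; have Hh : H' h by exact: derived_of_sub Dh.
  rewrite sub_capmx; apply/andP; split.
    by rewrite mulmxBr addmx_sub ?HU ?eqmx_opp ?mulmx1 //; exact: H'H.
  apply/sub_kermxP; rewrite -mulmxA mulmxBl mulmxBr -TC // mul1mx mulmxA.
  by rewrite (fix2 h Dh) subrr.
move=> x y Dx Dy.
have Hx : H x by apply: H'H; exact: derived_of_sub Dx.
have Hy : H y by apply: H'H; exact: derived_of_sub Dy.
have prod g h : derived_of H' k.*2 g -> derived_of H' k.*2 h ->
    U *m (rho g *m rho h) = U *m rho g + U *m rho h - U.
  move=> Dg Dh; have /submxP [Y YE] := diff g Dg.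
  have : U *m (rho g - 1%:M) *m (rho h - 1%:M) = 0.
    by rewrite YE -mulmxA mulmxBr (fix1 h Dh) mulmx1 subrr mulmx0.
  rewrite (mulmxBr U) mulmx1 mulmxBl !mulmxBr !mulmx1 -mulmxA => /eqP.
  rewrite subr_eq0 subr_eq => /eqP ->.
  by rewrite addrAC [U *m rho h + _]addrC.
apply: (fixes_commutator sH HU Hx Hy).
by rewrite prod // prod // [U *m rho x + _]addrC.
Qed.

End NilpotentLinear.

(** * Reduction of linear groups modulo primes *)

Lemma finite_expr_fixed (K : closedFieldType) q : (1 < q)%N ->
  exists rs : seq K, forall x, x ^+ q = x -> x \in rs.
Proof.
move=> q1; pose P : {poly K} := 'X^q - 'X.
have sP : size P = q.+1.
  by rewrite size_polyDl size_polyXn // size_polyN size_polyX ltnS.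
have [rs Pr] := closed_field_poly_normal P; exists rs => x xq.
have : root P x by rewrite /root !hornerE xq subrr.
rewrite Pr rootZ ?root_prod_XsubC //.
by rewrite lead_coef_eq0 -size_poly_eq0 sP.
Qed.

Lemma finite_matrices (K : nzRingType) m (rs : seq K) :
  finite_set [set A : 'M[K]_m | forall i j, A i j \in rs].
Proof.
pose g (t : {ffun 'I_m * 'I_m -> 'I_(size rs)}) : 'M[K]_m :=
  \matrix_(i, j) rs`_(t (i, j)).
apply: (@sub_finite_set _ _ (g @` setT)); last exact/finite_image/finite_finset.
move=> A Ars.
have ltA ij : (index (A ij.1 ij.2) rs < size rs)%N by rewrite index_mem.
exists [ffun ij => Ordinal (ltA ij)] => //.
by apply/matrixP => i j; rewrite mxE ffunE /= nth_index.
Qed.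

(* The finite group [G / N] satisfies (a), hence is nilpotent. *)
Lemma finite_image_lower_central (G : groupType) (T : Type) (N : normalSubgroup G)
  (F : set T) (f : G -> T) : finitely_generated G -> unimodularly_closed G ->
  finite_set F -> (forall x, F (f x)) ->
  (forall x y, f x = f y -> ns_set N (x^-1 * y)%g) ->
  exists n, lower_central n `<=` ns_set N.
Proof.
move=> fgG uG finF Ff fN.
have finQ : finite_set [set: quot_group N].
  (* [h] recovers a coset from the value of [f] at its representative; the default 1 only serves
     values that are not attained. *)
  pose h t := xget (1%g : quot_group N) [set a | f (repr a) = t].
  apply: (@sub_finite_set _ _ (h @` F)); last exact: finite_image.
  move=> a _; exists (f (repr a)) => //.
  rewrite /h; case: xgetP => [b -> /= /fN|/(_ a) /(_ erefl)//].
  by move=> /quot_proj_eq; rewrite !quot_projK.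
have : nilpotent_group (quot_group N).
  apply: nilpotent_of_quotients; first exact: quot_finitely_generated.
    move=> M ntM; exists setT; split; [exact: setT_normal|exact: ntM|left].
    by rewrite -quot_proj_setT; exact: finite_image.
  exact: quot_unimodularly_closed.
move=> /nilpotentE [n Ln]; exists n => x Lx; apply/quot_proj_eq1.
by apply: Ln; rewrite quot_lower_central; exists x.
Qed.

Section LinearGroups.
Variables (G : groupType) (F : fieldType) (m : nat) (f : {multiplicative G -> GL F m}).
Hypothesis f_inj : injective f.
Hypothesis fgG : finitely_generated G.
Hypothesis uG : unimodularly_closed G.

Let rho (g : G) : 'M[F]_m := val (f g).

Let rhoM x y : rho (x * y)%g = rho x *m rho y.
Proof. by rewrite /rho gmulfM. Qed.

Let rho1 : rho 1%g = 1%:M.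
Proof.
have : (f 1%g * f 1%g = f 1%g * 1)%g by rewrite -gmulfM !mulg1.
by move=> /mulgI; rewrite /rho => ->.
Qed.

(* The entries of [G] lie in a finitely generated subring of [F], the image of
   [h]; it is lifted to [R] so that it can be reduced modulo primes. *)
Lemma linear_lift : exists (R : comNzRingType) (h : {rmorphism R -> F}) (L : G -> 'M[R]_m),
  finite_residues R /\ forall g, map_mx h (L g) = rho g.
Proof.
have [s gens] := fgG.
pose es := [seq rho g ij.1 ij.2 | g <- s ++ [seq x^-1%g | x <- s], ij <- enum {: 'I_m * 'I_m}].
have [R [h [frR hes]]] := finite_residues_cover es.
pose lifts g := exists M, map_mx h M = rho g.
have lift_mem g : g \in s ++ [seq x^-1%g | x <- s] -> lifts g.
  move=> gs; have ex ij : exists r, h r = rho g ij.1 ij.2.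
    by apply: hes; apply/allpairsP; exists (g, ij); rewrite mem_enum.
  have [r hr] := choice ex; exists (\matrix_(i, j) r (i, j)).
  by apply/matrixP => i j; rewrite !mxE hr.
have all_lift g : lifts g.
  have : gen_subgroup [set` s] g by rewrite gens.
  move=> /(_ [set g | lifts g /\ lifts g^-1%g]) [||//]; last first.
    move=> x xs; split; apply: lift_mem; rewrite mem_cat ?xs //.
    by rewrite map_f ?orbT.
  have lM x y : lifts x -> lifts y -> lifts (x * y)%g.
    by move=> [A AE] [B BE]; exists (A *m B); rewrite map_mxM AE BE rhoM.
  split=> [|x y [Lx Lx'] [Ly Ly']|x [Lx Lx']] /=; last by rewrite invgK.
  - have l1 : lifts 1%g by exists 1%:M; rewrite map_mx1 rho1.
    by rewrite invg1.
  - by rewrite invgM; split; exact: lM.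
have [L hL] := choice all_lift.
by exists R, h, L.
Qed.

Lemma linear_solvable : solvable_group G.
Proof.
have [R [h [L [frR hL]]]] := linear_lift.
pose P r := h r = 0.
have pP : is_prime_ideal P.
  split; rewrite /P.
  - exact: rmorph0.
  - by move=> a b ha hb; rewrite rmorphD ha hb addr0.
  - by move=> a b hb; rewrite rmorphM hb mulr0.
  - by move/eqP; rewrite rmorph1 oner_eq0.
  - by move=> a b /eqP; rewrite rmorphM mulf_eq0 => /orP [/eqP|/eqP]; [left|right].
exists m.*2; apply: normal_sub1; first exact: derived_series_normal.
move=> g Dg; apply: contrapT => g1.
have [i [j nPij]] : exists i j, ~ P ((L g - 1%:M) i j).
  apply: contrapT => no; apply: g1; apply: f_inj; apply: val_inj.
  rewrite -[LHS]/(rho g) -[RHS]/(rho 1%g) rho1 -hL.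
  apply/matrixP => i j; apply/eqP; rewrite -subr_eq0; apply/eqP.
  have /contrapT : ~ ~ P ((L g - 1%:M) i j) by move=> nP; apply: no; exists i, j.
  by rewrite /P !mxE rmorphB rmorph_nat.
have [K [p [red [[chK _] redP redij [e e_gt0 rede]]]]] := frR P _ pP nPij.
have red_eq (A B : 'M[R]_m) : map_mx h A = map_mx h B -> map_mx red A = map_mx red B.
  move=> /matrixP AB; apply/matrixP => k l; have := AB k l; rewrite !mxE => hAB.
  apply/eqP; rewrite -subr_eq0 -rmorphB redP //.
  by rewrite /P rmorphB hAB subrr.
(* [L] is multiplicative only modulo the kernel of [h]; as [red] kills that kernel, [sigma] is a
   homomorphism. *)
pose sigma x := map_mx red (L x).
have sigma1 : sigma 1%g = 1%:M.
  by rewrite -(map_mx1 red); apply: red_eq; rewrite hL rho1 map_mx1.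
have sigmaM x y : sigma (x * y)%g = sigma x *m sigma y.
  by rewrite /sigma -map_mxM; apply: red_eq; rewrite map_mxM !hL rhoM.
have nS : is_normal [set x | fixes sigma 1%:M x].
  split=> [|x y]; first exact: fixes_subgroup.
  rewrite /= /fixes !mul1mx => sx.
  by rewrite /conjg !sigmaM sx mul1mx -sigmaM mulVg.
pose N := NormalSubgroup nS.
have p_pr := pcharf_prime chK.
have [rs rsP] : exists rs : seq K, forall x, x ^+ (p ^ e) = x -> x \in rs.
  by apply: finite_expr_fixed; rewrite -(exp1n e) ltn_exp2r // prime_gt1.
have [n Ln] : exists n, lower_central n `<=` ns_set N.
  apply: (finite_image_lower_central (f := sigma) fgG uG (@finite_matrices K m rs)).
    by move=> x k l; rewrite mxE; apply: rsP; exact: rede.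
  move=> x y xy; rewrite /= /fixes mul1mx sigmaM -xy -sigmaM mulVg.
  exact: sigma1.
have : fixes sigma 1%:M g.
  apply: (@nilpotent_linear_derived _ _ _ _ sigma1 sigmaM m setT _ n) => //.
  - by move=> x _; exact: submx1.
  - by rewrite lower_central_ofT.
  - exact: rank_leq_row.
  - by rewrite derived_ofT.
rewrite /fixes mul1mx => /matrixP /(_ i j); rewrite !mxE => sg.
move: redij; rewrite !mxE rmorphB rmorph_nat -sg.
by rewrite subrr eqxx.
Qed.

End LinearGroups.

Lemma linear_unimodularly_closed_solvable (G : groupType) :
  finitely_generated G -> linear_group G -> unimodularly_closed G ->
  solvable_group G.
Proof. by move=> fgG [F [m [H [f [_ _ f_inj _]]]]] uG; exact: linear_solvable f_inj fgG uG. Qed.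

Theorem mainTheorem2 (G : groupType) (hfg : finitely_generated G) :
  (solvable_group G -> quotients_have_finite_or_abelian_normal G) /\
  (quotients_have_finite_or_abelian_normal G \/ linear_group G ->
     (unimodularly_closed G <-> nilpotent_group G)).
Proof.
split=> [|h]; first exact: solvable_quotients.
split=> [uG|]; last exact: nilpotent_unimodularly_closed.
apply: nilpotent_of_quotients => //; case: h => // lG.
by apply: solvable_quotients; exact: linear_unimodularly_closed_solvable.
Qed.
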